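(* Let $\alpha>0$ and let $\{m_k\}_{k\ge0}$ be a sequence of real numbers with $m_k=1$ for every even $k$. Let $L_k=0$ for $k$ odd and $$L_k=\frac{1}{\alpha k+1}\sum_{\gamma\in\Gamma_k}\prod_{i<0}m_{\mathbbm{l}_i(\gamma)}\quad\text{for }k\text{ even}.$$ Then the numbers $L_k$, $k\ge0$, are the moments of the Ullman distribution $\nu_\alpha(dx)=h_\alpha(x)\,dx$, where $$h_\alpha(x)=\mathbf{1}_{[-2,2]}(x)\,\frac{1}{\alpha\pi}\int_{|x|/2}^{1}\frac{t^{-1+1/\alpha}}{\sqrt{4t^2-x^2}}\,dt .$$ The measure $\nu_\alpha$ is the distribution of $T^{\alpha}W$, where $W$ has the arcsine law $\mathbf{1}_{[-2,2]}(x)\frac{1}{\pi\sqrt{4-x^2}}dx$ and $T$ is uniform on $[0,1]$ and independent of $W$. In particular (for almost every $x$), $$h_{1/4}(x)=\mathbf{1}_{[-2,2]}(x)\frac{(2+x^2)\sqrt{4-x^2}}{6\pi},\qquad h_{1/2}(x)=\mathbf{1}_{[-2,2]}(x)\frac{1}{2\pi}\sqrt{4-x^2},$$ $$h_{1}(x)=\mathbf{1}_{[-2,2]}(x)\frac{1}{2\pi}\log\left(\frac{2+\sqrt{4-x^2}}{|x|}\right).$$ In particular, for the $\beta$-ensemble tridiagonal model described in the context (any $\beta>0$), with $X_n=n^{-1/2}A_n$, the limiting eigenvalue distribution is the semicircular law: for every $k\ge0$ the quantities $\mathrm{tr}_n(X_n^k)$ converge as $n\to\infty$, in expectation and almost surely,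 to the $k$-th moment of $\frac{1}{2\pi}\mathbf{1}_{[-2,2]}(x)\sqrt{4-x^2}\,dx$.
   Context: Paths: for $k\ge1$, $\Gamma_k$ is the set of all $\gamma=(j_1,\dots,j_{k+1})\in\mathbb{Z}^{k+1}$ with $j_1=j_{k+1}$, $|j_u-j_{u+1}|=1$ for $1\le u\le k$, and $\max_u j_u=0$; $\Gamma_0=\{(0)\}$. For a path $\gamma$ and $i\in\mathbb{Z}$, $\mathbbm{l}_i(\gamma)$ is the number of $u\in\{1,\dots,k\}$ with $\{j_u,j_{u+1}\}=\{i,i+1\}$ (number of crossings of the line $y=i+1/2$). $\beta$-ensemble model: $\{d_n\}_{n\ge1}$, $\{b_n\}_{n\ge1}$ are all independent, $\sqrt{\beta}\,d_n$ has the normal law $N(0,2)$ with mean $0$ and variance $2$, and $\sqrt{\beta}\,b_n$ has the $\chi$ distribution with $n\beta$ degrees of freedom (density on $(0,\infty)$ proportional to $x^{n\beta-1}e^{-x^2/2}$). $A_n$ is the $n\times n$ symmetric tridiagonal matrix with diagonal $d_n,d_{n-1},\dots,d_1$ and off-diagonal $b_{n-1},\dots,b_1$, from top to bottom. $\mathrm{tr}_n(Y)=\frac1n\sum_{i=1}^n y_{i,i}$. *)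

(* Defs.v *)
From HB Require Import structures.
From mathcomp Require Import all_boot all_order all_algebra finmap.
From mathcomp Require Import all_classical all_reals all_analysis.
From mathcomp Require Import measurable_realfun.

Set Implicit Arguments.
Unset Strict Implicit.
Unset Printing Implicit Defensive.

Import Order.TTheory GRing.Theory Num.Theory.
Import numFieldNormedType.Exports.

Local Open Scope classical_set_scope.
Local Open Scope ring_scope.

(* [gamma`_u] is the coordinate j_(u+1): coordinates are numbered from 0. *)
Definition Gamma (k : nat) : set (k.+1.-tuple int) :=
  [set gamma | [/\ gamma`_0 = gamma`_k,
    forall u, (u < k)%N -> `|gamma`_u - gamma`_u.+1| = 1
  & \big[Num.max/gamma`_0]_(j <- gamma) j = 0]].

Arguments Gamma k : clear implicits.

Definition crossings (k : nat) (i : int) (gamma : k.+1.-tuple int) : nat :=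
  #|[set u : 'I_k | (gamma`_u == i) && (gamma`_u.+1 == i + 1)
                 || (gamma`_u == i + 1) && (gamma`_u.+1 == i)]|.

(* The sum over the finite set [Gamma k] and the product over all i < 0, where
   all but finitely many factors are m 0 = 1, are finite-support big
   operators. *)
Definition path_moment (R : realType) (alpha : R) (m : nat -> R) (k : nat) : R :=
  if odd k then 0 else
  (alpha * k%:R + 1)^-1 *
  \sum_(gamma \in Gamma k)
    \big[*%R/1]_(i \in [set i : int | i < 0]) m (crossings i gamma).

Definition density_measure (R : realType) (f : R -> \bar R)
    (f_ge0 : forall x, (0 <= f x)%E) (mf : measurable_fun [set: R] f) :
    set _ -> \bar R :=
  fun A => (\int[lebesgue_measure]_(x in A) f x)%E.

Section density_measure_is_measure.
Variables (R : realType) (f : R -> \bar R).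
Hypotheses (f_ge0 : forall x, (0 <= f x)%E) (mf : measurable_fun [set: R] f).

Let density_measure0 : density_measure f_ge0 mf set0 = 0%E.
Proof. exact: integral_set0. Qed.

Let density_measure_ge0 A : (0 <= density_measure f_ge0 mf A)%E.
Proof. exact: integral_ge0. Qed.

Let density_measure_sigma_additive :
  semi_sigma_additive (density_measure f_ge0 mf).
Proof.
move=> /= F mF tF mUF; rewrite /density_measure ge0_integral_bigcup//=.
- by apply: is_cvg_ereal_nneg_natsum_cond => // n _ _; exact: integral_ge0.
- exact: measurable_funTS.
Qed.

HB.instance Definition _ := isMeasure.Build _ _ _ (density_measure f_ge0 mf)
  density_measure0 density_measure_ge0 density_measure_sigma_additive.

End density_measure_is_measure.

(* Extended-real valued: the integral is infinite at x = 0 when 1 <= alpha. *)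
Definition ullman_pdf (R : realType) (alpha x : R) : \bar R :=
  ((\1_`[-2, 2] x * (1 / (alpha * pi)))%R%:E *
   \int[lebesgue_measure]_(t in `[(`|x| / 2)%R, 1%R])
     (t `^ (-1 + 1 / alpha) / Num.sqrt (4 * t ^+ 2 - x ^+ 2))%R%:E)%E.

Definition arcsine_pdf (R : realType) (x : R) : R :=
  \1_`[-2, 2] x * (1 / (pi * Num.sqrt (4 - x ^+ 2))).

Definition semicircle_pdf (R : realType) (x : R) : R :=
  \1_`[-2, 2] x * (1 / (2 * pi) * Num.sqrt (4 - x ^+ 2)).

Definition chi_kernel (R : realType) (nu x : R) : R :=
  \1_`]0, +oo[ x * (x `^ (nu - 1) * expR (- x ^+ 2 / 2)).

Definition chi_pdf (R : realType) (nu x : R) : R :=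
  chi_kernel nu x / \int[lebesgue_measure]_y chi_kernel nu y.

Section densities.
Variable R : realType.
Implicit Types alpha nu x : R.

Lemma ullman_pdf_ge0 alpha (alpha_gt0 : 0 < alpha) x :
  (0 <= ullman_pdf alpha x)%E.
Proof.
apply: mule_ge0.
  by rewrite lee_fin mulr_ge0// divr_ge0// mulr_ge0 ?pi_ge0// ltW.
by apply: integral_ge0 => t _; rewrite lee_fin divr_ge0 ?powR_ge0 ?sqrtr_ge0.
Qed.

Lemma measurable_sqrtr : measurable_fun [set: R] (@Num.sqrt R).
Proof. by apply: continuous_measurable_fun; exact: sqrt_continuous. Qed.

Lemma measurable_inv_sqrt d (U : measurableType d) (f : U -> R) :
  measurable_fun [set: U] f ->
  measurable_fun [set: U] (fun u => (Num.sqrt (f u))^-1).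
Proof.
move=> mf; rewrite (_ : (fun _ => _) = fun u => Num.sqrt (f u) `^ (-1)).
  apply: (measurableT_comp (measurable_powR _) _).
  exact: (measurableT_comp measurable_sqrtr mf).
by apply/funext => x; rewrite powR_inv1// sqrtr_ge0.
Qed.

Lemma measurable_ullman_pdf alpha : measurable_fun [set: R] (ullman_pdf alpha).
Proof.
pose D := [set p : R * R | `|p.1| / 2 <= p.2 <= 1].
pose g (p : R * R) : \bar R :=
  (\1_D p * (p.2 `^ (-1 + 1 / alpha)
             / Num.sqrt (4 * p.2 ^+ 2 - p.1 ^+ 2)))%:E.
have mD : measurable D.
  rewrite (_ : D =
    (fun p => (`|p.1| / 2 <= p.2) && (p.2 <= 1)) @^-1` [set true])//.
  rewrite -[X in measurable X]setTI; apply: (@measurable_and) => //.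
    apply: measurable_fun_ler; last exact: measurable_snd.
    apply: measurable_funM => //; apply: measurableT_comp => //.
  apply: measurable_fun_ler => //; exact: measurable_snd.
have mg : measurable_fun [set: R * R] g.
  apply/measurable_EFinP; apply: measurable_funM; first exact: measurable_indic.
  apply: measurable_funM.
    apply: (measurableT_comp (measurable_powR _)); exact: measurable_snd.
  apply: measurable_inv_sqrt; apply: measurable_funB; last first.
    apply: measurable_funX; exact: measurable_fst.
  apply: measurable_funM => //; apply: measurable_funX; exact: measurable_snd.
have g0 p : (0 <= g p)%E.
  by rewrite lee_fin mulr_ge0// divr_ge0 ?powR_ge0 ?sqrtr_ge0.
rewrite (_ : ullman_pdf alpha = fun x =>
    ((\1_`[-2, 2] x * (1 / (alpha * pi)))%R%:E *
     \int[lebesgue_measure]_t g (x, t))%E); last first.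
  apply/funext => x; rewrite /ullman_pdf; congr (_ * _)%E.
  rewrite integral_mkcond; apply: eq_integral => t _.
  rewrite /g /patch indicE
    (_ : ((x, t) \in D) = (t \in `[(`|x| / 2), 1]%classic)).
    by case: ifP; rewrite ?mul1r ?mul0r.
  by apply/idP/idP; rewrite !inE.
apply: emeasurable_funM.
  by apply/measurable_EFinP; apply: measurable_funM => //.
exact: (@measurable_fun_fubini_tonelli_F _ _ R (measurableTypeR R) R
  lebesgue_measure g).
Qed.

Lemma arcsine_pdf_ge0 x : (0 <= (arcsine_pdf x)%:E)%E.
Proof.
by rewrite lee_fin mulr_ge0// divr_ge0// mulr_ge0// ?pi_ge0 ?sqrtr_ge0.
Qed.

Lemma measurable_arcsine_pdf :
  measurable_fun [set: R] (fun x => (arcsine_pdf x)%:E).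
Proof.
apply/measurable_EFinP; apply: measurable_funM; first exact: measurable_indic.
rewrite (_ : (fun _ => _) =
    fun x => pi^-1 * (Num.sqrt (4 - x ^+ 2))^-1).
  apply: measurable_funM => //; apply: measurable_inv_sqrt.
  by apply: measurable_funB => //; exact: measurable_funX.
by apply/funext => x; rewrite div1r invfM.
Qed.

Lemma semicircle_pdf_ge0 x : (0 <= (semicircle_pdf x)%:E)%E.
Proof.
rewrite lee_fin mulr_ge0// mulr_ge0 ?sqrtr_ge0// divr_ge0// mulr_ge0//.
exact: pi_ge0.
Qed.

Lemma measurable_semicircle_pdf :
  measurable_fun [set: R] (fun x => (semicircle_pdf x)%:E).
Proof.
apply/measurable_EFinP; apply: measurable_funM; first exact: measurable_indic.
apply: measurable_funM => //.
apply: (measurableT_comp measurable_sqrtr).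
by apply: measurable_funB => //; exact: measurable_funX.
Qed.

Lemma chi_kernel_ge0 nu x : 0 <= chi_kernel nu x.
Proof. by rewrite !mulr_ge0 ?powR_ge0 ?expR_ge0. Qed.

Lemma chi_pdf_ge0 nu x : (0 <= (chi_pdf nu x)%:E)%E.
Proof.
rewrite lee_fin divr_ge0 ?chi_kernel_ge0// Rintegral_ge0// => y _.
exact: chi_kernel_ge0.
Qed.

Lemma measurable_chi_pdf nu :
  measurable_fun [set: R] (fun x => (chi_pdf nu x)%:E).
Proof.
apply/measurable_EFinP; apply: measurable_funM => //.
apply: measurable_funM; first exact: measurable_indic.
apply: measurable_funM; first exact: measurable_powR.
apply: measurableT_comp => //; apply: measurable_funM => //.
by apply: measurableT_comp => //; exact: measurable_funX.
Qed.

End densities.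

Definition ullman (R : realType) (alpha : R) (alpha_gt0 : 0 < alpha) :
    {measure set _ -> \bar R} :=
  density_measure (ullman_pdf_ge0 alpha_gt0) (measurable_ullman_pdf alpha).

Definition arcsine (R : realType) : {measure set _ -> \bar R} :=
  density_measure (@arcsine_pdf_ge0 R) (@measurable_arcsine_pdf R).

Definition semicircle (R : realType) : {measure set _ -> \bar R} :=
  density_measure (@semicircle_pdf_ge0 R) (@measurable_semicircle_pdf R).

Definition chi_distribution (R : realType) (nu : R) :
    {measure set _ -> \bar R} :=
  density_measure (@chi_pdf_ge0 R nu) (@measurable_chi_pdf R nu).

Definition has_law (R : realType) d (Omega : measurableType d)
    (P : probability Omega R) (X : Omega -> R) (mu : set R -> \bar R) :=
  forall A : set R, measurable A -> P (X @^-1` A) = mu A.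

Definition independent2 (R : realType) d (Omega : measurableType d)
    (P : probability Omega R) (X Y : {RV P >-> R}) :=
  forall A B : set R, measurable A -> measurable B ->
  P ((X @^-1` A) `&` (Y @^-1` B)) = (P (X @^-1` A) * P (Y @^-1` B))%E.

Definition independent_family (R : realType) d (Omega : measurableType d)
    (P : probability Omega R) (I : choiceType) (X : I -> {RV P >-> R}) :=
  forall (J : {fset I}) (A : I -> set R), (forall i, measurable (A i)) ->
  P (\bigcap_(i in [set` J]) (X i @^-1` A i)) =
  (\prod_(i <- J) P (X i @^-1` A i))%E.

(* Both sequences start at index 1: [dv 0] and [bv 0] are unconstrained. *)
Definition beta_model (R : realType) (beta : R) d (Omega : measurableType d)
    (P : probability Omega R) (dv bv : nat -> {RV P >-> R}) :=
  [/\ independent_family (fun s : nat + nat =>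
        match s with inl n => dv n.+1 | inr n => bv n.+1 end),
      forall n, (1 <= n)%N -> has_law P (fun w => Num.sqrt beta * dv n w)
        (normal_prob 0 (Num.sqrt 2))
    & forall n, (1 <= n)%N -> has_law P (fun w => Num.sqrt beta * bv n w)
        (chi_distribution (n%:R * beta))].

(* Rows and columns are numbered from 0: row i carries d_(n - i) on the
   diagonal and b_(n - 1 - i) immediately to its right. *)
Definition beta_matrix (R : realType) (dv bv : nat -> R) (n : nat) : 'M[R]_n :=
  \matrix_(i < n, j < n)
    (if i == j then dv (n - i)%N
     else if j == i.+1 :> nat then bv (n - j)%N
     else if i == j.+1 :> nat then bv (n - i)%N
     else 0).

Definition scaled_beta_matrix (R : realType) (dv bv : nat -> R) (n : nat) :
    'M[R]_n :=
  (Num.sqrt n%:R)^-1 *: beta_matrix dv bv n.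

Definition normalized_trace (R : realType) (n : nat) (Y : 'M[R]_n) : R :=
  n%:R^-1 * \tr Y.

(* Main.v *)
From HB Require Import structures.
From mathcomp Require Import all_boot all_order all_algebra finmap.
From mathcomp Require Import all_classical all_reals all_analysis.
From mathcomp Require Import measurable_realfun.
From mathcomp Require Import ring lra zify.
Require Import Defs.

Import Order.TTheory GRing.Theory Num.Theory.
Import numFieldNormedType.Exports.

Local Open Scope classical_set_scope.
Local Open Scope ring_scope.

(** The integer which ties all the parts together is [walks k 0], the number of
    closed walks of length k with steps +1 and -1.

    Combinatorics. A closed path crosses every line an even number of times, so
    all the factors m equal 1 and [path_moment] merely counts [Gamma k]. A path
    of [Gamma k] is determined by its steps, since the condition on the maximum
    fixes its level, so [Gamma k] has [walks k 0] elements ([path_momentE]).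

    The law. Let u and v be independent and uniform on [0, 1]. The variable
    v^alpha has density t^(1/alpha - 1) / alpha on ]0, 1[, and for fixed t the
    variable -2t cos(pi u) has density 1 / (pi sqrt(4t^2 - x^2)) on ]-2t, 2t[.
    The product of the two densities, integrated in t, is [ullman_pdf]; by
    Tonelli the Ullman law is therefore the law of -2 v^alpha cos(pi u)
    ([ullman_law]). Since the case t = 1 is the arcsine law, this is the claim on
    T^alpha W ([has_law_powR_mul]). It also factorizes the moments: v^(alpha k)
    has mean 1 / (alpha k + 1), while (-2 cos(pi u))^k has mean [walks k 0],
    because multiplication by 2 cos th turns cos(r th) into the sum of its two
    neighbours cos((r - 1) th) and cos((r + 1) th) ([integral_cos_walks]).
    The closed forms for alpha = 1/4, 1/2 and 1 come from explicit primitives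
    in t.

    The matrices. Away from the corners, the diagonal entry of the k-th power of
    the tridiagonal matrix in the row carrying d_a is a sum over closed walks of
    products of d and b with indices near a. If d_n / sqrt n tends to 0 and
    b_n / sqrt n to 1, only the b count and this entry is equivalent to
    a^(k/2) [walks k 0]; the normalized trace is then a Riemann sum for
    [walks k 0] times the integral of x^(k/2) over [0, 1], that is the k-th
    moment for alpha = 1/2, the semicircle law ([cvg_normalized_trace]).

    The randomness enters only through the nonnegative series
    S = sum over n of (d_n^2 / n)^q + (b_n^2 / n - 1)^(2q). For q >= 2 it has
    finite expectation, as its n-th term has mean O(n^-q): d_n has bounded
    moments, and the centred moment of order 2q of a chi-square variable with nu
    degrees of freedom is O(nu^q). Where S is finite and all b_n are positive,
    both limits above hold, which gives almost sure convergence. For q > k, S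
    also bounds the traces of the k-th powers for all sizes at once
    ([normalized_trace_bound]), so that dominated convergence gives convergence
    in expectation. *)

(** * Laws of monotone functions of a uniform variable *)

Section FTC_open_interval.
Context {R : realType}.
Local Notation mu := (@lebesgue_measure R).

(** The densities below may blow up at the ends of their intervals, so that only
    the primitive extends continuously: exhaust ]a, b[ by compact intervals and
    pass to the limit on both sides. *)
Lemma ge0_continuous_FTC2_oo (f F : R -> R) (a b : R) : a < b ->
  {within `[a, b], continuous F} ->
  (forall x, a < x < b -> is_derive x 1 F (f x)) ->
  (forall x, a < x < b -> {for x, continuous f}) ->
  (forall x, a < x < b -> 0 <= f x) ->
  (\int[mu]_(x in `]a, b[) (f x)%:E = (F b - F a)%:E)%E.
Proof.
move=> ab cF dF cf f0.
have [_ Fa Fb] := (continuous_within_itvP F ab).1 cF.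
pose h n : R := (b - a) * n.+3%:R^-1.
have h0 n : 0 < h n by rewrite mulr_gt0 ?subr_gt0.
have hd n : h n < (b - a) / 2.
  by rewrite ltr_pM2l ?subr_gt0// ltf_pV2 ?posrE// ltr_nat.
have h_cvg : h n @[n --> \oo] --> (0 : R).
  rewrite -[X in _ --> X](mulr0 (b - a)); apply: cvgMr.
  have := @cvg_harmonic R; rewrite -(cvg_shiftn 2).
  by under eq_fun do rewrite addn2.
have h_ni m n : (m <= n)%N -> h n <= h m.
  by move=> mn; rewrite ler_pM2l ?subr_gt0// lef_pV2 ?posrE// ler_nat !ltnS.
have anbn n : a + h n < b - h n by have := hd n; lra.
pose A n : set R := `[a + h n, b - h n]%classic.
have sub n x : A n x -> a < x < b.
  by rewrite /A/= in_itv/=; have := h0 n; lra.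
have mf n : measurable_fun (A n) (EFin \o f).
  apply/measurable_EFinP.
  apply: subspace_continuous_measurable_fun; first exact: measurable_itv.
  apply: continuous_in_subspaceT => x /set_mem /sub; exact: cf.
have int_A n : (\int[mu]_(x in A n) (f x)%:E =
                (F (b - h n))%:E - (F (a + h n))%:E)%E.
  have dF' x : x \in `]a + h n, b - h n[ -> is_derive x 1 F (f x).
    by rewrite in_itv/= => /andP[x1 x2]; apply: dF; have := h0 n; lra.
  apply: continuous_FTC2 => //.
  - apply: continuous_in_subspaceT => x /set_mem /sub; exact: cf.
  - have : {within A n, continuous F}.
      apply: derivable_within_continuous => x xA; have := sub n x xA => /dF ?.
      exact: ex_derive.
    move=> /(continuous_within_itvP _ (anbn n))[_ ? ?]; split => //.
    by move=> x /dF' ?; exact: ex_derive.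
  - by move=> x /dF' ?; rewrite derive1E; exact: derive_val.
have UA : `]a, b[%classic = \bigcup_n A n.
  apply/seteqP; split=> x /=; last by move=> [n _ /sub]; rewrite in_itv.
  rewrite in_itv/= => /andP[ax xb].
  have : \forall n \near \oo, h n < Num.min (x - a) (b - x).
    by apply: (cvgr_lt _ h_cvg); rewrite lt_min !subr_gt0 ax.
  case=> n _ /(_ n (leqnn n)); rewrite /= lt_min => /andP[h1 h2].
  by exists n => //; rewrite /A/= in_itv/=; lra.
have nd : nondecreasing_seq A.
  move=> m n mn; apply/subsetPset => x; rewrite /A/= !in_itv/=.
  by have := h_ni _ _ mn; lra.
have mA n : measurable (A n) by exact: measurable_itv.
have lim1 : (\int[mu]_(x in A n) (f x)%:E)%E @[n --> \oo] -->
    (\int[mu]_(x in \bigcup_n A n) (f x)%:E)%E.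
  apply: ge0_nondecreasing_set_cvg_integral => //.
  by move=> n x /sub ?; rewrite lee_fin f0.
rewrite UA; apply: (cvg_unique _ lim1) => //=.
under eq_fun do rewrite int_A -EFinB.
apply: cvg_EFin; first exact: nearW.
apply: cvgB.
- apply: (cvg_at_leftP _ _ _).1 Fb (fun n => b - h n) _; split=> [n|].
    by rewrite ltrBlDr ltrDl.
  by rewrite -[X in _ --> X]subr0; apply: cvgB => //; exact: cvg_cst.
- apply: (cvg_at_rightP _ _ _).1 Fa (fun n => a + h n) _; split=> [n|].
    by rewrite ltrDl.
  by rewrite -[X in _ --> X]addr0; apply: cvgD => //; exact: cvg_cst.
Qed.

End FTC_open_interval.

Section transport.
Context {R : realType}.
Local Notation mu := (@lebesgue_measure R).

Lemma measure_eq_of_rays (m1 m2 : {measure set (measurableTypeR R) -> \bar R}) :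
  (m1 [set: R] < +oo)%E ->
  (forall x : R, m1 `]-oo, x]%classic = m2 `]-oo, x]%classic) ->
  forall A : set R, measurable A -> m1 A = m2 A.
Proof.
move=> m1T m12 A mA.
have m1_fin (B : set R) : measurable B -> (m1 B < +oo)%E.
  by move=> mB; rewrite (le_lt_trans _ m1T)// le_measure// inE.
have oc (m : {measure set (measurableTypeR R) -> \bar R}) (a b : R) : a <= b ->
    (m `]-oo, a]%classic < +oo)%E -> (m `]-oo, b]%classic < +oo)%E ->
    (m `]a, b]%classic = m `]-oo, b]%classic - m `]-oo, a]%classic)%E.
  move=> ab fa fb.
  have -> : `]a, b]%classic = `]-oo, b] `\` `]-oo, a].
    by rewrite -[RHS]setCK setCD setCitvl setUC -[LHS]setCK setCitv.
  by rewrite measureD ?setIidr//; exact: subset_itvl.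
pose g n : set R := `](- n%:R), n%:R]%classic.
have mG : @measurable _ (measurableTypeR R) = <<s @ocitv R >> by [].
have gg n : @ocitv R (g n) by exact: is_ocitv.
have gT : \bigcup_n g n = setT by rewrite -(bigcup_itvT false false).
have H := @measure_unique _ R (measurableTypeR R) (@ocitv R) g mG (@ocitvI R) gg gT m1 m2.
apply: H => //.
- move=> _ [[a b] /= _ <-]; have [ab|/ltW ba] := leP a b; last first.
    by rewrite set_itv_ge ?measure0// bnd_simp -leNgt.
  rewrite (oc m1) ?m1_fin// (oc m2) -?m12 ?m1_fin//.
- by move=> n; apply: m1_fin; exact: measurable_itv.
Qed.

(** Inverse transform sampling: when F is an increasing primitive of f, the
    measure with density f is the image of Lebesgue measure under the inverse
    phi of F. The two measures agree on rays, by
    [ge0_continuous_FTC2_oo] and the Galois connection between phi and F. *)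
Lemma density_transport (f F phi : R -> R) (a b : R) : a < b ->
  {within `[a, b], continuous F} ->
  (forall x, a < x < b -> is_derive x 1 F (f x)) ->
  (forall x, a < x < b -> {for x, continuous f}) ->
  (forall x, a < x < b -> 0 <= f x) ->
  measurable_fun [set: R] phi ->
  (forall u, F a < u < F b -> a < phi u < b) ->
  (forall x, a < x < b -> F a < F x < F b) ->
  (forall x u, a < x < b -> F a < u < F b -> (phi u <= x) = (u <= F x)) ->
  forall A : set R, measurable A ->
  (\int[mu]_(x in A `&` `]a, b[) (f x)%:E = mu (`]F a, F b[ `&` phi @^-1` A))%E.
Proof.
move=> ab cF dF cf f0 mphi phiI FI phiF A mA.
have mab : measurable (`]a, b[%classic : set R) by exact: measurable_itv.
have mFab : measurable (`]F a, F b[%classic : set R) by exact: measurable_itv.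
have mf : measurable_fun `]a, b[%classic f.
  apply: open_continuous_measurable_fun; first exact: interval_open.
  by move=> x /set_mem/=; rewrite in_itv/= => /cf.
pose g := (EFin \o f) \_ `]a, b[%classic.
have g0 x : (0 <= g x)%E.
  by apply: erestrict_ge0 => y /=; rewrite in_itv/= lee_fin => /f0.
have mg : measurable_fun [set: R] g.
  by apply: (measurable_restrictT (EFin \o f) mab).1; exact/measurable_EFinP.
pose m1 : {measure set (measurableTypeR R) -> \bar R} := density_measure g0 mg.
have m1E (B : set R) : measurable B -> m1 B = (\int[mu]_(x in B `&` `]a, b[) (f x)%:E)%E.
  by move=> mB; rewrite /m1/= /density_measure -integral_mkcondr.
have mphi' : @measurable_fun _ _ (measurableTypeR R) (measurableTypeR R)
  [set: R] phi := mphi.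
pose m2 : {measure set (measurableTypeR R) -> \bar R} :=
  measure_function_pushforward__canonical__measure_function_Measure
    (mrestr mu mFab) mphi'.
have m2E (B : set R) : m2 B = mu (`]F a, F b[ `&` phi @^-1` B).
  by rewrite /m2/= /pushforward /mrestr setIC.
have FTC x : a < x <= b -> (\int[mu]_(x in `]a, x[) (f x)%:E)%E = (F x - F a)%:E.
  move=> /andP[ax xb]; have sub y : a < y < x -> a < y < b by lra.
  apply: ge0_continuous_FTC2_oo => //.
  - apply: continuous_subspaceW cF; apply: subset_itvl; by rewrite bnd_simp.
  - by move=> y /sub/dF.
  - by move=> y /sub/cf.
  - by move=> y /sub/f0.
have Fab : F a < F b by have := FI ((a + b) / 2); lra.
rewrite -m1E// -m2E; apply: measure_eq_of_rays => //.
  by rewrite m1E// setTI FTC ?ab//= ltry.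
move=> x; rewrite m1E ?m2E; last exact: measurable_itv.
have [xa|ax] := leP x a.
  have -> : `]-oo, x] `&` `]a, b[ = set0.
    by apply/seteqP; split=> // u /= []; rewrite !in_itv/=; lra.
  rewrite [X in mu X](_ : _ = set0) ?integral_set0 ?measure0//.
  by apply/seteqP; split=> // u /= []; rewrite !in_itv/= => /phiI; lra.
have [bx|xb] := leP b x.
  have -> : `]-oo, x] `&` `]a, b[ = `]a, b[%classic.
    by apply/setIidr => u/=; rewrite !in_itv/=; lra.
  rewrite [X in mu X](_ : _ = `]F a, F b[%classic).
    by rewrite FTC ?ab//= lebesgue_measure_itv/= lte_fin Fab EFinB.
  by apply/setIidl => u/=; rewrite !in_itv/= => /phiI; lra.
have /FI/andP[Fax Fxb] : a < x < b by rewrite ax.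
rewrite (_ : `]-oo, x] `&` `]a, b[ = `]a, x]%classic); last first.
  by apply/seteqP; split=> u/=; rewrite !in_itv/=; lra.
rewrite [X in mu X](_ : _ = `]F a, F x]%classic); last first.
  apply/seteqP; split=> u/=; rewrite !in_itv/=.
    by move=> [uF]; rewrite phiF ?ax//; lra.
  move=> uF; have uab : F a < u < F b by lra.
  by rewrite phiF ?ax//; split=> //; lra.
rewrite lebesgue_measure_itv/= lte_fin Fax -EFinB -FTC ?ax ?ltW//.
rewrite integral_itv_bndo_bndc//; apply/measurable_EFinP.
by apply: measurable_funS mf => //; apply: subset_itvl; rewrite bnd_simp ltW.
Qed.
End transport.

Section laws.
Context {R : realType}.
Local Notation mu := (@lebesgue_measure R).

Lemma continuous_powR_gt0 (p x : R) : 0 < x -> {for x, continuous (@powR R ^~ p)}.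
Proof.
move=> x0; apply: differentiable_continuous; apply/derivable1_diffP.
by apply: (@derivable_powR R 1 p); rewrite in_itv/= x0.
Qed.

(** The primitive t^(1/alpha) of the density is inverse to v^alpha. *)
Lemma powR_law (alpha : R) : 0 < alpha ->
  forall A : set R, measurable A ->
  (\int[mu]_(t in A `&` `]0%R, 1%R[) (1 / alpha * t `^ (1 / alpha - 1))%:E =
   mu (`]0%R, 1%R[ `&` (@powR R ^~ alpha) @^-1` A))%E.
Proof.
move=> a0; have a'0 : 0 < 1 / alpha by rewrite divr_gt0.
have aK (v : R) : 0 <= v -> (v `^ alpha) `^ (1 / alpha) = v.
  by move=> v0; rewrite -powRrM div1r divff ?gt_eqF// powRr1.
have lt01 (p v : R) : 0 < p -> 0 < v < 1 -> 0 < v `^ p < 1.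
  move=> p0 /andP[v0 v1]; rewrite powR_gt0//=.
  have := @gt0_ltr_powR R p p0 v 1; rewrite powR1; apply=> //.
    by rewrite nnegrE ltW.
  by rewrite nnegrE ler01.
have le_pow (p x y : R) : 0 < p -> 0 <= x -> x <= y -> x `^ p <= y `^ p.
  move=> p0 x0 xy; apply: (@ge0_ler_powR R p (ltW p0)) => //; rewrite nnegrE//.
  exact: le_trans xy.
have h0 : 0 `^ (1 / alpha) = 0 :> R by rewrite powR0// gt_eqF.
have h1 : 1 `^ (1 / alpha) = 1 :> R by rewrite powR1.
move=> A mA.
have := @density_transport R (fun t => 1 / alpha * t `^ (1 / alpha - 1))
  (@powR R ^~ (1 / alpha)) (@powR R ^~ alpha) 0 1 ltr01.
rewrite h0 h1; apply=> //.
- apply/(continuous_within_itvP _ ltr01); split.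
  + by move=> x; rewrite in_itv/= => /andP[x0 _]; exact: continuous_powR_gt0.
  + by rewrite /= h0; exact: powR_cvg0.
  + by apply: cvg_at_left_filter; exact: continuous_powR_gt0.
- by move=> x /andP[x0 _]; exact: is_derive1_powR.
- move=> x /andP[x0 _]; apply: cvgM; first exact: cvg_cst.
  exact: continuous_powR_gt0.
- by move=> x _; rewrite mulr_ge0 ?powR_ge0// ltW.
- by move=> u; exact: lt01.
- by move=> u; exact: lt01.
- move=> x u /andP[x0 x1] /andP[u0 u1]; apply/idP/idP.
    by move=> ux; rewrite -(aK u (ltW u0)) le_pow// powR_ge0.
  by move=> ux; rewrite -(aK x (ltW x0)) powRAC le_pow// ltW.
Qed.

(** The primitive 1 - acos(x / 2t) / pi of the density is inverse to
    -2t cos(pi u); the sign makes the latter increasing on [0, 1]. *)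
Lemma arcsine_law (t : R) : 0 < t ->
  forall A : set R, measurable A ->
  (\int[mu]_(x in A `&` `](- (2 * t))%R, (2 * t)%R[)
      (1 / (pi * Num.sqrt (4 * t ^+ 2 - x ^+ 2)))%:E =
   mu (`]0%R, 1%R[ `&` (fun u => - (2 * t) * cos (pi * u))%R @^-1` A))%E.
Proof.
move=> t0 A mA.
have t20 : 0 < 2 * t by rewrite mulr_gt0.
have pi0 := pi_gt0 R.
pose F x : R := 1 - acos (x / (2 * t)) / pi.
pose phi u : R := - (2 * t) * cos (pi * u).
have t2K x : x / (2 * t) * (2 * t) = x by rewrite mulfVK// gt_eqF.
have bnd x : - (2 * t) < x < 2 * t -> -1 < x / (2 * t) < 1.
  by rewrite ltr_pdivlMr// ltr_pdivrMr// mulN1r mul1r; apply.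
have phiK u : 0 <= u <= 1 -> F (phi u) = u.
  move=> /andP[u0 u1]; rewrite /F /phi mulNr mulNr mulrAC divff ?gt_eqF// mul1r.
  rewrite acosN ?cos_geN1 ?cos_le1// cosK; last first.
    by rewrite in_itv/= mulr_ge0 ?pi_ge0//= ger_pMr.
  by rewrite mulrBl divff ?gt_eqF// mulrAC divff ?gt_eqF// mul1r opprB addrC subrK.
have phi0 : phi 0 = - (2 * t) by rewrite /phi mulr0 cos0 mulr1.
have phi1 : phi 1 = 2 * t by rewrite /phi mulr1 cospi mulrN1 opprK.
have F0 : F (- (2 * t)) = 0 by rewrite -phi0 phiK// lexx ler01.
have F1 : F (2 * t) = 1 by rewrite -phi1 phiK// lexx ler01.
have cphi : continuous phi.
  move=> u; apply: cvgM; first exact: cvg_cst.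
  apply: (@cvg_comp _ _ _ (fun u : R => pi * u) cos); last exact: continuous_cos.
  by apply: cvgM; [exact: cvg_cst|exact: cvg_id].
have FK x : - (2 * t) < x < 2 * t -> phi (F x) = x.
  move=> /bnd/andP[x1 x2].
  have -> : phi (F x) = - (2 * t) * cos (pi - acos (x / (2 * t))).
    rewrite /phi /F; congr (_ * cos _).
    by rewrite mulrBr mulr1 mulrCA divff ?mulr1 ?gt_eqF//.
  rewrite addrC cosDpi cosN acosK ?in_itv/= ?(ltW x1) ?(ltW x2)//.
  by rewrite mulrNN mulrC t2K.
have FI x : - (2 * t) < x < 2 * t -> 0 < F x < 1.
  move=> /bnd/andP[x1 x2].
  rewrite /F subr_gt0 ltr_pdivrMr// mul1r ltrBlDr ltrDl acos_ltpi ?x1 ?(ltW x2)//=.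
  by rewrite divr_gt0// acos_gt0// x2 ltW.
have phi_lt u v : 0 <= u <= 1 -> 0 <= v <= 1 -> (phi u <= phi v) = (u <= v).
  move=> /andP[u0 u1] /andP[v0 v1].
  rewrite !leNgt; congr (~~ _); rewrite /phi !mulNr ltrN2 ltr_pM2l// ltr_cos ?ltr_pM2l//.
    by rewrite in_itv/= mulr_ge0 ?pi_ge0//= ger_pMr.
  by rewrite in_itv/= mulr_ge0 ?pi_ge0//= ger_pMr.
have ab : - (2 * t) < 2 * t by lra.
have := @density_transport R (fun x => 1 / (pi * Num.sqrt (4 * t ^+ 2 - x ^+ 2)))
  F phi _ _ ab.
rewrite F0 F1; apply=> //.
- rewrite -phi0 -phi1; apply: segment_can_le_continuous; first exact: ler01.
    by apply: continuous_subspaceT.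
  by move=> u; rewrite in_itv/=; exact: phiK.
- move=> x xt; have /andP[x1 x2] := bnd _ xt.
  have d1 : is_derive x 1 (fun x : R => x / (2 * t)) (2 * t)^-1.
    rewrite (_ : (fun x => _) = (2 * t)^-1 \*: id); last first.
      by apply/funext => y; rewrite /= mulrC.
    by apply: is_derive_eq; rewrite /= scaler1.
  have d2 := @is_derive1_comp R acos _ x _ _ (is_derive1_acos (bnd _ xt)) d1.
  rewrite (_ : F = cst 1 - pi^-1 \*: (acos \o (fun x => x / (2 * t)))); last first.
    by apply/funext => y; rewrite /F /= mulrC.
  apply: is_derive_eq; rewrite sub0r /GRing.scale/=.
  have -> : 4 * t ^+ 2 - x ^+ 2 = (2 * t) ^+ 2 * (1 - (x / (2 * t)) ^+ 2).
    by field; rewrite gt_eqF.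
  rewrite sqrtrM ?sqr_ge0// sqrtr_sqr gtr0_norm//.
  have : Num.sqrt (1 - (x / (2 * t)) ^+ 2) != 0.
    by rewrite gt_eqF// sqrtr_gt0; nra.
  have pin0 : (pi : R) != 0 by rewrite gt_eqF.
  move: (Num.sqrt _) (pi : R) pin0 => s q q0 s0.
  by field; rewrite q0 s0 gt_eqF.
- move=> x xt; apply: cvgM; first exact: cvg_cst.
  have s0 : 0 < 4 * t ^+ 2 - x ^+ 2 by nra.
  apply: cvgV; first by rewrite mulf_neq0// gt_eqF// sqrtr_gt0.
  apply: cvgM; first exact: cvg_cst.
  apply: (@cvg_comp _ _ _ (fun x : R => 4 * t ^+ 2 - x ^+ 2) Num.sqrt).
    apply: cvgB; first exact: cvg_cst.
    exact: exprn_continuous.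
  exact: sqrt_continuous.
- by move=> x _; rewrite divr_ge0// mulr_ge0 ?pi_ge0// sqrtr_ge0.
- by apply: continuous_measurable_fun.
- move=> u /andP[u0 u1]; rewrite -/(phi u) -phi0 -phi1.
  rewrite !ltNge !phi_lt ?lexx ?ler01//; lra.
- move=> x u xt u01; rewrite -{1}(FK x xt) phi_lt//.
    by lra.
  by have := FI _ xt; lra.
Qed.
End laws.

Section uniform.
Context {R : realType}.
Local Notation mu := (@lebesgue_measure R).
Local Notation unif := (uniform_prob (@ltr01 R)).

Lemma uniform_probE (A : set R) : measurable A -> unif A = mu (`]0, 1[ `&` A).
Proof.
move=> mA; have mI : measurable_fun [set: R] (fun x => (\1_A x : R)%:E).
  by apply/measurable_EFinP; exact: measurable_indic.
transitivity (\int[unif]_x (\1_A x)%:E)%E.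
  by rewrite integral_indic// setIT.
rewrite integral_uniform//.
rewrite subr0 invr1 mul1e integral_itv_bndoo; last exact: measurable_funTS.
by rewrite integral_indic// setIC.
Qed.

Lemma powR_law_unif (alpha : R) : 0 < alpha ->
  forall A : set R, measurable A ->
  (\int[mu]_(t in A `&` `]0%R, 1%R[) (1 / alpha * t `^ (1 / alpha - 1))%:E =
   unif ((@powR R ^~ alpha) @^-1` A))%E.
Proof.
move=> a0 A mA; rewrite powR_law// uniform_probE//.
rewrite -[X in measurable X]setTI; exact: measurable_powR.
Qed.

Lemma measurable_scaled_cos (t : R) :
  measurable_fun [set: R] (fun u : R => - (2 * t) * cos (pi * u)).
Proof.
apply: continuous_measurable_fun => u; apply: cvgM; first exact: cvg_cst.
apply: (@cvg_comp _ _ _ (fun u : R => pi * u) cos); last exact: continuous_cos.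
by apply: cvgM; [exact: cvg_cst|exact: cvg_id].
Qed.

Lemma arcsine_law_unif (t : R) : 0 < t ->
  forall A : set R, measurable A ->
  (\int[mu]_(x in A `&` `](- (2 * t))%R, (2 * t)%R[)
      (1 / (pi * Num.sqrt (4 * t ^+ 2 - x ^+ 2)))%:E =
   unif ((fun u => - (2 * t) * cos (pi * u))%R @^-1` A))%E.
Proof.
move=> t0 A mA; rewrite arcsine_law// uniform_probE//.
rewrite -[X in measurable X]setTI; exact: measurable_scaled_cos.
Qed.

Lemma arcsineE (A : set R) : measurable A ->
  arcsine R A = unif ((fun u => - (2 * 1) * cos (pi * u))%R @^-1` A).
Proof.
move=> mA; rewrite -arcsine_law_unif// /arcsine/= /density_measure.
rewrite mulr1 expr1n mulr1.
pose g : R -> \bar R := EFin \o (fun x : R => 1 / (pi * Num.sqrt (4 - x ^+ 2))).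
have mg : measurable_fun [set: R] g.
  apply/measurable_EFinP.
  rewrite [X in measurable_fun _ X](_ : _ =
      fun x : R => pi^-1 * (Num.sqrt (4 - x ^+ 2))^-1).
    apply: measurable_funM => //; apply: measurable_inv_sqrt.
    by apply: measurable_funB => //; exact: measurable_funX.
  by apply/funext => x; rewrite div1r invfM.
transitivity (\int[mu]_(x in `[(-2)%R, 2%R]) (g \_ A) x)%E.
  rewrite -integral_mkcondr setIC.
  rewrite integral_mkcondr; apply: eq_integral => x xA.
  rewrite /arcsine_pdf patchE indicE /g/=; case: ifPn => _; rewrite ?mul1r ?mul0r.
    reflexivity.
  done.
rewrite integral_itv_bndoo; first by rewrite -integral_mkcondr setIC.
apply: measurable_funTS.
exact: ((measurable_restrictT g mA).1 (measurable_funTS mg)).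
Qed.
End uniform.

(** * The Ullman law as the law of a product *)

Section ullman_law.
Context {R : realType}.
Local Notation mu := (@lebesgue_measure R).
Local Notation unif := (uniform_prob (@ltr01 R)).

(** The joint density of (x, t) when t = v^alpha and, given t, the variable x is
    arcsine-distributed on ]-2t, 2t[. *)
Definition ullman_kernel (alpha : R) (z : R * R) : R :=
  \1_[set z : R * R | `|z.1| / 2 < z.2 < 1] z *
  (1 / (alpha * pi) *
   (z.2 `^ (-1 + 1 / alpha) / Num.sqrt (4 * z.2 ^+ 2 - z.1 ^+ 2))).

Lemma measurable_fst_lt_snd :
  measurable [set z : R * R | `|z.1| / 2 < z.2 < 1].
Proof.
rewrite (_ : [set _ | _] =
  (fun p : R * R => (`|p.1| / 2 < p.2) && (p.2 < 1)) @^-1` [set true])//.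
rewrite -[X in measurable X]setTI; apply: (@measurable_and) => //.
  apply: measurable_fun_ltr; last exact: measurable_snd.
  by apply: measurable_funM => //; apply: measurableT_comp.
apply: measurable_fun_ltr => //; exact: measurable_snd.
Qed.

Lemma measurable_ullman_kernel (alpha : R) :
  measurable_fun [set: R * R] (ullman_kernel alpha).
Proof.
apply: measurable_funM.
  by apply: measurable_indic; exact: measurable_fst_lt_snd.
apply: measurable_funM => //; apply: measurable_funM.
  apply: (measurableT_comp (measurable_powR _)); exact: measurable_snd.
apply: measurable_inv_sqrt; apply: measurable_funB; last first.
  apply: measurable_funX; exact: measurable_fst.
apply: measurable_funM => //; apply: measurable_funX; exact: measurable_snd.
Qed.

Lemma ullman_kernel_ge0 (alpha : R) z : 0 < alpha -> 0 <= ullman_kernel alpha z.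
Proof.
move=> a0; rewrite mulr_ge0// mulr_ge0//.
  by rewrite divr_ge0// mulr_ge0 ?pi_ge0// ltW.
by rewrite divr_ge0 ?powR_ge0 ?sqrtr_ge0.
Qed.

Lemma ullman_pdfE (alpha : R) x : 0 < alpha ->
  ullman_pdf alpha x = (\int[mu]_t (ullman_kernel alpha (x, t))%:E)%E.
Proof.
move=> a0; pose c := 1 / (alpha * pi).
have c0 : 0 <= c by rewrite divr_ge0// mulr_ge0 ?pi_ge0// ltW.
pose g (t : R) := t `^ (-1 + 1 / alpha) / Num.sqrt (4 * t ^+ 2 - x ^+ 2).
have mg : measurable_fun [set: R] g.
  apply: measurable_funM; first exact: measurable_powR.
  apply: measurable_inv_sqrt; apply: measurable_funB => //.
  by apply: measurable_funM => //; exact: measurable_funX.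
have g0 t : 0 <= g t by rewrite divr_ge0 ?powR_ge0 ?sqrtr_ge0.
have mEg D : measurable_fun D (fun t : R => (g t)%:E).
  by apply/measurable_EFinP; exact: measurable_funTS.
transitivity ((c%:E * \int[mu]_(t in `](`|x| / 2)%R, 1%R[) (g t)%:E)%E).
  rewrite /ullman_pdf integral_itv_bndoo//.
  have [x2|x2] := leP `|x| 2.
    have xI : x \in `[(-2)%R, 2%R]%classic by rewrite inE/= in_itv/= -ler_norml.
    by rewrite indicE xI [X in (X%:E * _)%E]mul1r.
  rewrite [X in (\int[_]_(_ in X) _)%E](_ : _ = set0) ?integral_set0 ?mule0//.
  by rewrite set_itv_ge// bnd_simp -leNgt ler_pdivlMr// mul1r ltW.
rewrite -(ge0_integralZl_EFin mu _ _ (mEg _) c0)//; last first.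
  by move=> t; rewrite lee_fin.
rewrite integral_mkcond; apply: eq_integral => t _.
rewrite patchE /ullman_kernel/= indicE.
have -> : ((x, t) \in [set z | `|z.1| / 2 < z.2 < 1]) =
    (t \in `](`|x| / 2), 1[%classic).
  by apply/idP/idP; rewrite !inE/= ?in_itv/=.
rewrite -EFinM -/c -/(g t).
by case: ifPn => _; [rewrite [in RHS]mul1r | rewrite [in RHS]mul0r].
Qed.

Let cosmap (z : R * R) : R := - (2 * z.1) * cos (pi * z.2).

Lemma measurable_cosmap : measurable_fun [set: R * R] cosmap.
Proof.
apply: measurable_funM.
  apply: (measurableT_comp (@oppr_measurable R setT)); apply: measurable_funM => //.
apply: (measurableT_comp (continuous_measurable_fun (@continuous_cos R))).
apply: measurable_funM => //; exact: measurable_snd.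
Qed.

Lemma integral_ullman_kernel (alpha t : R) (A : set R) :
  0 < alpha -> measurable A ->
  (\int[mu]_x ((\1_A x * ullman_kernel alpha (x, t))%:E) =
   ((\1_`]0, 1[%classic t * (1 / alpha * t `^ (1 / alpha - 1)))%:E *
   unif [set u | A (cosmap (t, u))]))%E.
Proof.
move=> a0 mA; rewrite indicE.
have [|t01] := boolP (t \in `]0, 1[%classic); last first.
  rewrite mul0r mul0e integral0_eq// => x _.
  rewrite (_ : ullman_kernel alpha (x, t) = 0) ?mulr0//.
  rewrite /ullman_kernel indicE memNset ?mul0r// => h.
  have /andP[xt t1] : `|x| / 2 < t < 1 := h.
  move: t01; rewrite notin_setE/= in_itv/= t1 andbT; apply.
  by apply: le_lt_trans xt; rewrite divr_ge0.
rewrite inE/= in_itv/= => /andP[t0 t1]; rewrite [X in (X%:E * _)%E]mul1r.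
rewrite -[X in (_ * X)%E](@arcsine_law_unif R t t0 A mA).
pose f x := 1 / (pi * Num.sqrt (4 * t ^+ 2 - x ^+ 2)).
have f0 x : 0 <= f x by rewrite divr_ge0// mulr_ge0 ?pi_ge0// sqrtr_ge0.
pose c := 1 / alpha * t `^ (1 / alpha - 1).
have c0 : 0 <= c by rewrite mulr_ge0 ?powR_ge0// divr_ge0// ltW.
have mf : measurable_fun [set: R] f.
  rewrite (_ : f = fun x => pi^-1 * (Num.sqrt (4 * t ^+ 2 - x ^+ 2))^-1).
    apply: measurable_funM => //; apply: measurable_inv_sqrt.
    by apply: measurable_funB => //; exact: measurable_funX.
  by apply/funext => x; rewrite /f div1r invfM.
have mEf D : measurable_fun D (fun x : R => (f x)%:E).
  by apply/measurable_EFinP; exact: measurable_funTS.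
transitivity (c%:E * \int[mu]_(x in A `&` `](- (2 * t))%R, (2 * t)%R[) (f x)%:E)%E;
  last by [].
rewrite -(ge0_integralZl_EFin mu _ _ (mEf _) c0)//; last 2 first.
- by apply: measurableI => //; exact: measurable_itv.
- by move=> x _; rewrite lee_fin.
rewrite [RHS]integral_mkcond; apply: eq_integral => x _.
rewrite patchE in_setI /ullman_kernel.
have -> : \1_[set z : R * R | `|z.1| / 2 < z.2 < 1] (x, t) =
    (x \in `](- (2 * t)), (2 * t)[%classic)%:R :> R.
  rewrite indicE; congr (nat_of_bool _)%:R.
  by apply/idP/idP; rewrite !inE/= in_itv/= t1 andbT ltr_pdivrMr// mulrC -ltr_norml.
rewrite indicE; case: (x \in A); last by rewrite /= mulr0n mul0r.
case: (x \in _); last by rewrite /= mulr0n mul0r mulr0.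
rewrite /= !mulr1n ![X in X%:E = _]mul1r; congr EFin.
rewrite /c /f (addrC (-1)) !div1r !invfM.
by rewrite !mulrA; congr (_ / _); rewrite -!mulrA (mulrC pi^-1).
Qed.

Definition ullman_map (alpha : R) (z : R * R) : R :=
  - (2 * z.1 `^ alpha) * cos (pi * z.2).

Lemma measurable_ullman_map (alpha : R) :
  measurable_fun [set: R * R] (ullman_map alpha).
Proof.
apply: measurable_funM.
  apply: (measurableT_comp (@oppr_measurable R setT)); apply: measurable_funM => //.
  apply: (measurableT_comp (measurable_powR _)); exact: measurable_fst.
apply: (measurableT_comp (continuous_measurable_fun (@continuous_cos R))).
apply: measurable_funM => //; exact: measurable_snd.
Qed.

(** Two applications of Tonelli: integrating the kernel in x first turns the
    inner integral into a probability for u ([integral_ullman_kernel]), and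
    exchanging again turns the remaining integral in t into a probability
    for v ([powR_law_unif]). *)
Lemma ullman_law (alpha : R) (alpha_gt0 : 0 < alpha) (A : set R) :
  measurable A ->
  ullman alpha_gt0 A = (unif \x unif)%E (ullman_map alpha @^-1` A).
Proof.
move=> mA.
pose T := measurableTypeR R.
have m1A : measurable_fun [set: R] (\1_A : R -> R) by exact: measurable_indic.
transitivity (\int[mu]_x \int[mu]_t
    (\1_A x * ullman_kernel alpha (x, t))%:E)%E.
  rewrite /ullman/= /density_measure integral_mkcond; apply: eq_integral => x _.
  rewrite patchE indicE ullman_pdfE//; case: ifPn => xA.
    by apply: eq_integral => t _; rewrite mul1r.
  by rewrite integral0_eq// => t _; rewrite mul0r.
have mk : measurable_fun [set: R * R]
    (fun z => (\1_A z.1 * ullman_kernel alpha z)%:E).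
  apply/measurable_EFinP; apply: measurable_funM.
    exact: (measurableT_comp m1A measurable_fst).
  exact: measurable_ullman_kernel.
rewrite (@fubini_tonelli _ _ T T R mu mu _ mk); last first.
  by move=> z; rewrite lee_fin mulr_ge0// ullman_kernel_ge0.
under eq_integral do rewrite integral_ullman_kernel//.
pose rho (t : R) := \1_`]0, 1[%classic t * (1 / alpha * t `^ (1 / alpha - 1)).
have rho0 t : 0 <= rho t.
  by rewrite mulr_ge0// mulr_ge0 ?powR_ge0// divr_ge0// ltW.
have mrho : measurable_fun [set: R] rho.
  apply: measurable_funM; first by apply: measurable_indic.
  by apply: measurable_funM => //; exact: measurable_powR.
pose B := cosmap @^-1` A.
have mB : measurable B.
  by rewrite -[B]setTI; exact: measurable_cosmap.
have m1B : measurable_fun [set: R * R] (\1_B : R * R -> R).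
  exact: measurable_indic.
have msecB t : measurable [set u | A (cosmap (t, u))].
  rewrite -[X in measurable X]setTI; exact: (measurable_scaled_cos t).
transitivity (\int[mu]_t \int[unif]_u (rho t * \1_B (t, u))%:E)%E.
  apply: eq_integral => t _.
  under [RHS]eq_integral do rewrite EFinM.
  have mBt : measurable_fun [set: R] (fun u : R => (\1_B (t, u) : R)%:E).
    by apply/measurable_EFinP; exact: (measurableT_comp m1B (measurable_pair1 t)).
  rewrite (@ge0_integralZl_EFin _ T R unif _ measurableT _ _ mBt)//.
  congr (_ * _)%E.
  transitivity (\int[unif]_u (\1_[set u | A (cosmap (t, u))] u : R)%:E)%E.
    by rewrite (@integral_indic _ T R unif _ measurableT _ (msecB t)) setIT.
  by apply: eq_integral => u _; rewrite !indicE; congr (nat_of_bool _)%:R%:E;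
    apply/idP/idP; rewrite !inE.
have mrB : measurable_fun [set: R * R] (fun z => (rho z.1 * \1_B z)%:E).
  apply/measurable_EFinP; apply: measurable_funM m1B.
  exact: (measurableT_comp mrho measurable_fst).
rewrite (@fubini_tonelli _ _ T T R mu unif _ mrB); last first.
  by move=> z; rewrite lee_fin mulr_ge0.
pose C := ullman_map alpha @^-1` A.
have mC : measurable C by rewrite -[C]setTI; exact: measurable_ullman_map.
(* The integral in t is now the inner one, as in the second construction of the
   product measure. *)
have -> : (unif \x unif)%E C = (unif \x^ unif)%E C.
  apply: (@product_measure_unique _ _ T T R unif unif) mC.
  by move=> X Y mX mY; exact: product_measure2E.
rewrite /product_measure2; apply: eq_integral => u _ /=.
pose Bu := [set t | A (cosmap (t, u))].
have mBu : measurable Bu.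
  rewrite -[X in measurable X]setTI.
  exact: (measurableT_comp measurable_cosmap (measurable_pair2 u)).
transitivity (unif ((@powR R ^~ alpha) @^-1` Bu)); last first.
  by congr (unif _); apply/seteqP; split => v; rewrite /ysection/= inE.
rewrite -powR_law_unif// [RHS]integral_mkcond; apply: eq_integral => t _.
rewrite patchE in_setI /rho !indicE.
have -> : ((t, u) \in B) = (t \in Bu) by apply/idP/idP; rewrite !inE.
case: (t \in Bu); last by rewrite /= mulr0n mulr0.
case: (t \in _); last by rewrite /= mulr0n !mul0r.
by rewrite /= !mulr1n mulr1 [X in X%:E = _]mul1r.
Qed.
End ullman_law.

Section product_law.
Context {R : realType}.
Local Notation unif := (uniform_prob (@ltr01 R)).

(** Independence says that the joint law of the two variables is a product on
    rectangles, hence everywhere. Realizing the arcsine factor as -2 cos(pi u)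
    brings the claim down to [ullman_law]. *)
Lemma has_law_powR_mul (alpha : R) (alpha_gt0 : 0 < alpha)
    (d : measure_display) (Omega : measurableType d)
    (P : probability Omega R) (X Y : {RV P >-> R}) :
  has_law P X unif -> has_law P Y (@arcsine R) -> independent2 X Y ->
  has_law P (fun w => X w `^ alpha * Y w) (ullman alpha_gt0).
Proof.
move=> lawX lawY XY A mA; rewrite ullman_law//.
pose T := measurableTypeR R.
pose phi (u : T) : T := - (2 * 1) * cos (pi * u).
have mphi : @measurable_fun _ _ T T [set: T] phi := measurable_scaled_cos 1.
pose phim : {mfun T >-> T} := HB.pack phi (isMeasurableFun.Build _ _ T T phi mphi).
pose law2 : probability T R := distribution unif phim.
have law2E (B : set R) : measurable B -> law2 B = arcsine R B.
  by move=> mB; rewrite arcsineE.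
pose Z w : T * T := (X w, Y w).
have mZ : @measurable_fun _ _ Omega (T * T)%type [set: Omega] Z.
  by apply/measurable_fun_pairP; split; [exact: (@measurable_funPT _ _ _ _ X)|exact: (@measurable_funPT _ _ _ _ Y)].
pose lawZ : {measure set (T * T) -> \bar R} :=
  measure_function_pushforward__canonical__measure_function_Measure P mZ.
have lawZE (B : set (T * T)) : measurable B -> lawZ B = (unif \x law2)%E B.
  move=> mB; apply/esym; apply: (@product_measure_unique _ _ T T R unif law2) mB.
  move=> B1 B2 mB1 mB2.
  rewrite /lawZ/= /pushforward (_ : Z @^-1` _ = (X @^-1` B1) `&` (Y @^-1` B2))//.
  by rewrite XY// lawX// lawY// -law2E.
pose B := (fun z : T * T => z.1 `^ alpha * z.2) @^-1` A.
have mB : measurable B.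
  rewrite -[B]setTI.
  have : measurable_fun [set: R * R] (fun z : R * R => z.1 `^ alpha * z.2).
    apply: measurable_funM; last exact: measurable_snd.
    by apply: (measurableT_comp (measurable_powR _)); exact: measurable_fst.
  exact.
transitivity (lawZ B); first by [].
rewrite (lawZE _ mB) /product_measure1; apply: eq_integral => t _ /=.
rewrite /distribution /pushforward; congr (unif _).
apply/seteqP; split=> u; rewrite /xsection/= !inE /B /ullman_map /phi/=.
  by rewrite mulrA mulrN mulr1 (mulrC _ 2).
by rewrite mulrA mulrN mulr1 (mulrC _ 2).
Qed.
End product_law.

(** * Moments of the Ullman law *)

(** The number of walks of length k with steps +1 and -1 that end at r. *)
Fixpoint walks (k : nat) (r : int) : nat :=
  if k is k'.+1 then (walks k' (r - 1) + walks k' (r + 1))%N else (r == 0 : nat).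

Section moments.
Context {R : realType}.
Local Notation unif := (uniform_prob (@ltr01 R)).
Local Notation T := (measurableTypeR R).

Lemma bounded_integrable d (S : measurableType d) (P : probability S R)
    (f : S -> R) (M : R) : measurable_fun [set: S] f ->
  (forall x, `|f x| <= M) -> P.-integrable [set: S] (fun x => (f x)%:E).
Proof.
move=> mf fM; apply: measurable_bounded_integrable => //.
  by rewrite (le_lt_trans (probability_le1 P measurableT))// ltry.
exists M; split; first exact: num_real.
by move=> K MK x _; rewrite /= (le_trans (fM x)) ?ltW.
Qed.

Lemma sin_natmul_pi (n : nat) : sin (n%:R * pi) = 0 :> R.
Proof.
elim: n => [|n IHn]; first by rewrite mul0r sin0.
by rewrite -natr1 mulrDl mul1r sinDpi IHn oppr0.
Qed.

(** Half-periods of the cosine starting at 0 have mean 0. The integral formula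
    at hand is for nonnegative functions, hence the detour through 1 + cos. *)
Lemma integral_cos_unif (n : nat) :
  (\int[unif]_u (cos (n.+1%:R * (pi * (1 - u))))%:E = 0)%E.
Proof.
have n0 : (n.+1%:R * pi : R) != 0 by rewrite mulf_neq0// gt_eqF// pi_gt0.
pose f u : R := cos (n.+1%:R * (pi * (1 - u))).
pose F u : R := u - sin (n.+1%:R * (pi * (1 - u))) / (n.+1%:R * pi).
have cf : continuous f.
  move=> u; apply: (@cvg_comp _ _ _ (fun u : R => n.+1%:R * (pi * (1 - u))) cos);
    last exact: continuous_cos.
  apply: cvgM; first exact: cvg_cst.
  apply: cvgM; first exact: cvg_cst.
  by apply: cvgB; [exact: cvg_cst|exact: cvg_id].
have mf : measurable_fun [set: T] f by exact: (continuous_measurable_fun cf).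
have intf : unif.-integrable [set: T] (EFin \o f).
  by apply: (@bounded_integrable _ _ unif f 1) => // u; exact: cos_max.
have H : (\int[unif]_u (1 + f u)%:E = 1)%E.
  have mf1 : measurable_fun [set: R] (fun u => 1 + f u).
    exact: measurable_funD.
  have f10 u : 0 <= 1 + f u by have := cos_geN1 (n.+1%:R * (pi * (1 - u))); rewrite /f; lra.
  rewrite integral_uniform//; last exact/measurable_EFinP.
  rewrite subr0 invr1 mul1e integral_itv_bndoo; last first.
    by apply/measurable_EFinP; exact: measurable_funTS.
  have dF (u : R) : is_derive u 1 F (1 + f u).
    have d1 : is_derive u 1 (fun u : R => n.+1%:R * (pi * (1 - u))) (- (n.+1%:R * pi)).
      rewrite (_ : (fun u => _) = (n.+1%:R * pi) \*: (cst 1 - id)); last first.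
        by apply/funext => v; rewrite /= mulrA.
      by apply: is_derive_eq; rewrite sub0r scalerN /GRing.scale/= mulr1.
    have d2 := @is_derive1_comp R sin _ u _ _ (is_derive_sin _) d1.
    rewrite (_ : F = id - (n.+1%:R * pi)^-1 \*: (sin \o (fun u => n.+1%:R * (pi * (1 - u)))));
      last first.
      by apply/funext => v; rewrite /F /= mulrC.
    apply: is_derive_eq; rewrite /GRing.scale/= mulrN mulrN opprK.
    by rewrite -/(f u) mulrCA mulVf ?mulr1.
  rewrite (@ge0_continuous_FTC2_oo R (fun u => 1 + f u) F)//.
  - rewrite /F !subrr !subr0 !mulr0 sin0 mul0r subr0 mulr1.
    by rewrite sin_natmul_pi mul0r !subr0.
  - apply: derivable_within_continuous => u _; exact: ex_derive.
  - by move=> u _; apply: cvgD; [exact: cvg_cst|exact: cf].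
have : (\int[unif]_u (1 + f u)%:E = 1 + \int[unif]_u (f u)%:E)%E.
  under eq_integral do rewrite EFinD.
  rewrite integralD//.
    congr (_ + _)%E; rewrite (integral_cst unif measurableT) mul1e.
    exact: (@probability_setT _ _ _ unif).
  by apply: (@bounded_integrable _ _ unif (cst 1) 1) => // u; rewrite /= normr1.
rewrite H; have : (\int[unif]_u (f u)%:E)%E \is a fin_num by exact: integrable_fin_num.
rewrite /f; case: (integral _ _ _) => // r _ /(congr1 fine)/= r1.
by congr EFin; lra.
Qed.

(** With th = pi (1 - u), the base -2 cos(pi u) is 2 cos th, and
    2 cos th cos(r th) = cos((r - 1) th) + cos((r + 1) th) is the recursion
    defining [walks]; a frequency r <> 0 has mean 0. *)
Lemma integral_cos_walks (k : nat) (r : int) :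
  (\int[unif]_u ((- (2 * cos (pi * u))) ^+ k *
     cos (r%:~R * (pi * (1 - u))))%:E = (walks k r)%:R%:E)%E.
Proof.
have mcos (r' : int) : measurable_fun [set: R] (fun u : R => cos (r'%:~R * (pi * (1 - u)))).
  apply: (measurableT_comp (continuous_measurable_fun (@continuous_cos R))).
  apply: measurable_funM => //; apply: measurable_funM => //.
  exact: measurable_funB.
pose X (u : R) := - (2 * cos (pi * u)).
have mX : measurable_fun [set: R] X.
  apply: (measurableT_comp (@oppr_measurable R setT)); apply: measurable_funM => //.
  apply: (measurableT_comp (continuous_measurable_fun (@continuous_cos R))).
  exact: measurable_funM.
have XE u : X u = 2 * cos (pi * (1 - u)).
  by rewrite /X mulrBr mulr1 addrC cosDpi cosN mulrN.
have intX k' r' : unif.-integrable [set: T]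
    (fun u => (X u ^+ k' * cos (r'%:~R * (pi * (1 - u))))%:E).
  apply: (@bounded_integrable _ _ unif _ (2 ^+ k')).
    by apply: measurable_funM; [exact: measurable_funX|exact: mcos].
  move=> u; rewrite normrM normrX -[leRHS]mulr1 ler_pM ?exprn_ge0// ?cos_max//.
  by rewrite lerXn2r ?nnegrE// XE normrM ger0_norm// ler_piMr// cos_max.
elim: k r => [|k IHk] r.
  under eq_integral do rewrite expr0 mul1r.
  rewrite /=; case: eqP => [->|/eqP r0].
    under eq_integral do rewrite mul0r cos0.
    rewrite (integral_cst unif measurableT) mul1e.
    exact: (@probability_setT _ _ _ unif).
  have cosr u : cos (r%:~R * (pi * (1 - u))) =
     cos ((`|r|.-1.+1%:R : R) * (pi * (1 - u))).
    rewrite prednK ?absz_gt0// natr_absz intr_norm.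
    by case: ger0P => _; rewrite ?mulNr ?cosN.
  under eq_integral do rewrite cosr.
  exact: integral_cos_unif.
rewrite /= natrD EFinD -!IHk -integralD//.
apply: eq_integral => u _; rewrite -EFinD -mulrDr exprSr -mulrA; congr (_ * _)%:E.
rewrite (XE u : - (2 * cos (pi * u)) = _); set th := pi * (1 - u).
rewrite intrB intrD [in RHS]mulrBl [in RHS]mulrDl mul1r cosB cosD.
by ring.
Qed.

Lemma integral_powR_unif (a : R) (k : nat) : 0 < a ->
  (\int[unif]_v ((v `^ a) ^+ k)%:E = ((a * k%:R + 1)^-1)%:E)%E.
Proof.
move=> a0; pose p := a * k%:R.
have p0 : 0 <= p by rewrite mulr_ge0// ltW.
have p1 : 0 < p + 1 by lra.
have mp : measurable_fun [set: R] (fun v : R => (v `^ a) ^+ k).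
  by apply: measurable_funX; exact: measurable_powR.
rewrite integral_uniform//; last 2 first.
- exact/measurable_EFinP.
- by move=> v; rewrite lee_fin exprn_ge0// powR_ge0.
rewrite subr0 invr1 mul1e integral_itv_bndoo; last first.
  by apply/measurable_EFinP; exact: measurable_funTS.
have E v : (v `^ a) ^+ k = v `^ p by rewrite -powR_mulrn ?powR_ge0// -powRrM.
under eq_integral do rewrite E.
transitivity ((1 `^ (p + 1) / (p + 1) - 0 `^ (p + 1) / (p + 1) : R)%:E); last first.
  by rewrite powR1 powR0 ?gt_eqF// mul0r subr0 div1r.
apply: (@ge0_continuous_FTC2_oo R (fun v => v `^ p)
  (fun v => v `^ (p + 1) / (p + 1)) 0 1) => //.
- have -> : (fun v : R => v `^ (p + 1) / (p + 1)) = (fun v => v `^ (p + 1)) * cst (p + 1)^-1 by [].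
  apply/(continuous_within_itvP _ ltr01); split.
  + move=> v; rewrite in_itv/= => /andP[v0 _]; apply: cvgM; last exact: cvg_cst.
    exact: continuous_powR_gt0.
  + rewrite /= {2}/GRing.mul/= powR0 ?gt_eqF//; apply: cvgM; last exact: cvg_cst.
    exact: powR_cvg0.
  + apply: cvgM; last exact: cvg_cst.
    by apply: cvg_at_left_filter; exact: continuous_powR_gt0.
- move=> v /andP[v0 _]; have d1 := is_derive1_powR (p + 1) v0.
  rewrite (_ : (fun v => _) = (p + 1)^-1 \*: (fun v => v `^ (p + 1))); last first.
    by apply/funext => w; rewrite /= mulrC.
  by apply: is_derive_eq; rewrite /GRing.scale/= addrK mulrA mulVf ?gt_eqF// mul1r.
- by move=> v /andP[v0 _]; exact: continuous_powR_gt0.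
- by move=> v _; rewrite powR_ge0.
Qed.

(** By [ullman_law] the moment is the integral of a product of a function of v
    and a function of u over a product measure. *)
Lemma ullman_moment (alpha : R) (alpha_gt0 : 0 < alpha) (k : nat) :
  (ullman alpha_gt0).-integrable [set: R] (fun x => (x ^+ k)%:E) /\
  (\int[ullman alpha_gt0]_x (x ^+ k)%:E =
   ((alpha * k%:R + 1)^-1 * (walks k 0)%:R)%:E)%E.
Proof.
have mmap : @measurable_fun _ _ (T * T)%type T [set: T * T] (ullman_map alpha).
  exact: measurable_ullman_map.
pose law : {measure set T -> \bar R} :=
  measure_function_pushforward__canonical__measure_function_Measure
    (unif \x unif)%E mmap.
have lawE (A : set T) : measurable A -> A `<=` [set: T] ->
    ullman alpha_gt0 A = law A.
  by move=> mA _; rewrite ullman_law.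
pose g (v : R) := (v `^ alpha) ^+ k.
pose h (u : R) := (- (2 * cos (pi * u))) ^+ k.
have E z : ullman_map alpha z ^+ k = g z.1 * h z.2.
  by rewrite /ullman_map /g /h -exprMn; congr (_ ^+ k); ring.
have g0 v : 0 <= g v by rewrite exprn_ge0// powR_ge0.
have mg : measurable_fun [set: T] g.
  by apply: measurable_funX; exact: measurable_powR.
have mh : measurable_fun [set: T] h.
  apply: measurable_funX.
  apply: (measurableT_comp (@oppr_measurable R setT)); apply: measurable_funM => //.
  apply: (measurableT_comp (continuous_measurable_fun (@continuous_cos R))).
  exact: measurable_funM.
have mEg : measurable_fun [set: T] (fun v => (g v)%:E) by exact/measurable_EFinP.
have h_le u : `|h u| <= 2 ^+ k.
  rewrite normrX lerXn2r ?nnegrE// normrN normrM ger0_norm// ler_piMr//.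
  exact: cos_max.
have inth : unif.-integrable [set: T] (fun u => (h u)%:E).
  exact: (@bounded_integrable _ _ unif h (2 ^+ k)).
have intg := integral_powR_unif alpha k alpha_gt0.
have iE : (\int[unif]_u (h u)%:E = (walks k 0)%:R%:E)%E.
  rewrite -integral_cos_walks; apply: eq_integral => u _.
  by rewrite mul0r cos0 mulr1.
pose f (z : T * T) := (g z.1 * h z.2)%:E.
have mf : measurable_fun [set: T * T] f.
  apply/measurable_EFinP; apply: measurable_funM.
    exact: (measurableT_comp mg measurable_fst).
  exact: (measurableT_comp mh measurable_snd).
pose H := (\int[unif]_u `|(h u)%:E|)%E.
have H_fin : (H < +oo)%E by have /integrableP[] := inth.
have H0 : (0 <= H)%E by apply: integral_ge0 => u _; exact: abse_ge0.
have intf : (unif \x unif)%E.-integrable [set: T * T] f.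
  apply/(integrable12ltyP _ _ mf).
  rewrite [ltLHS](_ : _ = (\int[unif]_v ((g v)%:E * H))%E); last first.
    apply: eq_integral => v _.
    rewrite -ge0_integralZl_EFin//; last first.
      by apply: measurableT_comp => //; exact/measurable_EFinP.
    by apply: eq_integral => u _; rewrite /f/= normrM EFinM (ger0_norm (g0 v)).
  rewrite ge0_integralZr//; last by move=> v _; rewrite lee_fin.
  by rewrite intg lte_mul_pinfty// lee_fin invr_ge0 addr_ge0// mulr_ge0// ltW.
have mX : measurable_fun [set: T] (fun x : T => (x ^+ k)%:E).
  by apply/measurable_EFinP; exact: measurable_funX.
have intp : (unif \x unif)%E.-integrable [set: T * T]
    ((fun x : T => (x ^+ k)%:E) \o ullman_map alpha).
  by apply: eq_integrable intf => // z _; rewrite /f/= E.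
have int_law : law.-integrable [set: T] (fun x => (x ^+ k)%:E).
  by apply: integrable_pushforward.
split.
  have /integrableP[m1 fin1] := int_law; apply/integrableP; split => //.
  by rewrite (eq_measure_integral _ lawE).
rewrite (eq_measure_integral _ lawE).
rewrite /law integral_pushforward// preimage_setT.
transitivity (\int[(unif \x unif)%E]_z f z)%E.
  by apply: eq_integral => z _; rewrite /f/= E.
rewrite -integral12_prod_meas1//.
transitivity (\int[unif]_v ((g v)%:E * (walks k 0)%:R%:E))%E.
  apply: eq_integral => v _; rewrite /fubini_F -iE -integralZl//.
by rewrite ge0_integralZr// ?intg// => v _; rewrite lee_fin.
Qed.

End moments.

(** * Counting the paths of Gamma *)

Fixpoint sign_words (k : nat) : seq (seq bool) :=
  if k is k'.+1 then
    [seq true :: s | s <- sign_words k'] ++ [seq false :: s | s <- sign_words k']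
  else [:: [::]].

Definition step (b : bool) : int := if b then 1 else -1.

(** The position after u steps of the walk whose up-steps are the true letters. *)
Definition height (s : seq bool) (u : nat) : int :=
  \sum_(0 <= j < u) step (nth false s j).

Lemma mem_sign_words k s : (s \in sign_words k) = (size s == k).
Proof.
elim: k s => [|k IHk] [|b s] //=; rewrite mem_cat.
  by apply/negbTE/norP; split; apply/mapP => -[].
have cons_inj (c : bool) : injective (cons c) by move=> x y [].
rewrite eqSS -IHk; case: b; rewrite mem_map//.
  by rewrite orbC; case: mapP => [[]|] //.
by case: mapP => [[]|] //.
Qed.

Lemma sign_words_uniq k : uniq (sign_words k).
Proof.
elim: k => //= k IHk.
have cons_inj (c : bool) : injective (cons c) by move=> x y [].
rewrite cat_uniq !map_inj_uniq// IHk/= andbT -all_predC.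
by apply/allP => _ /mapP[s _ ->] /=; apply/mapP => -[].
Qed.

Lemma count_sign_words k (r : int) :
  count (fun s => height s k == r) (sign_words k) = walks k r.
Proof.
elim: k r => [|k IHk] r /=.
  by rewrite /height big_geq// addn0 eq_sym.
rewrite count_cat !count_map -!IHk; congr (_ + _)%N; apply: eq_count => s /=;
  rewrite /height big_nat_recl//= /step; apply/eqP/eqP; lia.
Qed.

Lemma walks_parity k (r q : int) : r = k%:Z + 1 + 2 * q -> walks k r = 0%N.
Proof.
elim: k r q => [|k IHk] r q rE /=; first by case: eqP => //; lia.
by rewrite (IHk _ q) ?(IHk _ (q + 1)) => //; lia.
Qed.

Lemma walks_odd k : odd k -> walks k 0 = 0%N.
Proof.
by move=> ok; apply: (@walks_parity k 0 (- (uphalf k)%:Z)); lia.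
Qed.

(** The maximum in [Gamma] is taken with a member of the list as default value;
    this describes it without reference to the order of the list. *)
Lemma bigmax_intP (s : seq int) (x : int) :
  \big[Num.max/x]_(j <- s) j \in x :: s /\
  forall j, j \in x :: s -> j <= \big[Num.max/x]_(j <- s) j.
Proof.
elim: s => [|y s [IH1 IH2]]; first by rewrite big_nil inE; split=> // j; rewrite inE => /eqP->.
rewrite big_cons; split.
  rewrite maxEle; case: ifP => _; move: IH1; rewrite !inE ?eqxx ?orbT//.
  by move=> /orP[->//|->]; rewrite !orbT.
move=> j; rewrite !inE le_max => /or3P[/eqP->|/eqP->|js].
- by rewrite IH2 ?inE ?eqxx ?orbT.
- by rewrite lexx.
- by rewrite IH2 ?inE ?js ?orbT.
Qed.

Section Gamma_count.
Variable k : nat.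

Definition word_of_path (gamma : k.+1.-tuple int) : seq bool :=
  mkseq (fun u => gamma`_u.+1 - gamma`_u == 1) k.

Definition peak (s : seq bool) : int :=
  \big[Num.max/0]_(j <- mkseq (height s) k.+1) j.

(** The walk is shifted down by its peak so that its maximum becomes 0. *)
Definition path_of_word (s : seq bool) : k.+1.-tuple int :=
  mktuple (fun u : 'I_k.+1 => height s u - peak s).

Lemma nth_path_of_word s u : (u <= k)%N ->
  (path_of_word s)`_u = height s u - peak s.
Proof.
move=> uk; have uk' : (u < k.+1)%N by [].
by rewrite (_ : u = nat_of_ord (Ordinal uk'))// -tnth_nth tnth_mktuple.
Qed.

Lemma height0 s : height s 0 = 0. Proof. by rewrite /height big_geq. Qed.

Lemma heightS s u : height s u.+1 = height s u + step (nth false s u).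
Proof. by rewrite /height big_nat_recr. Qed.

Lemma path_of_wordK s : size s = k -> word_of_path (path_of_word s) = s.
Proof.
move=> sk; apply: (@eq_from_nth _ false); rewrite size_mkseq// => u uk.
rewrite nth_mkseq// !nth_path_of_word ?(ltnW uk)// heightS.
by rewrite /step; case: nth; apply/eqP; lia.
Qed.

Lemma path_of_word_Gamma s : size s = k -> height s k = 0 ->
  Gamma k (path_of_word s).
Proof.
move=> sk hk; have [p1 p2] := bigmax_intP (mkseq (height s) k.+1) 0.
rewrite -/(peak s) in p1 p2.
have h0 : 0 \in mkseq (height s) k.+1.
  by apply/mapP; exists 0%N; rewrite ?height0// mem_iota.
split.
- by rewrite !nth_path_of_word// height0 hk.
- move=> u uk; rewrite !nth_path_of_word ?(ltnW uk)// heightS /step.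
  by case: nth; lia.
have [q1 q2] := bigmax_intP (path_of_word s) (path_of_word s)`_0.
set m := \big[_/_]_(_ <- _) _ in q1 q2 *.
have mem_path u : (u <= k)%N -> height s u - peak s \in (path_of_word s)`_0 :: path_of_word s.
  move=> uk; rewrite inE -nth_path_of_word// mem_nth ?orbT// size_tuple//.
apply/eqP; rewrite eq_le; apply/andP; split.
  have : m \in path_of_word s.
    by move: q1; rewrite inE => /orP[/eqP->|//]; rewrite mem_nth// size_tuple.
  move=> /(nthP 0)[u]; rewrite size_tuple ltnS => uk <-.
  rewrite nth_path_of_word// subr_le0 p2// inE; apply/orP; right.
  by apply/mapP; exists u; rewrite // mem_iota.
have : peak s \in mkseq (height s) k.+1 by move: p1; rewrite inE => /orP[/eqP->|].
move=> /mapP[u]; rewrite mem_iota/= add0n ltnS => uk pE.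
by have := q2 _ (mem_path u uk); rewrite -pE subrr.
Qed.

Lemma word_of_pathK gamma : Gamma k gamma ->
  path_of_word (word_of_path gamma) = gamma /\
  height (word_of_path gamma) k = 0.
Proof.
move=> [g0k gS gmax]; set s := word_of_path gamma.
have hE u : (u <= k)%N -> height s u = gamma`_u - gamma`_0.
  elim: u => [|u IHu] uk; first by rewrite height0 subrr.
  rewrite heightS IHu ?(ltnW uk)// nth_mkseq// /step.
  have := gS u uk; move: (gamma`_u) (gamma`_u.+1) (gamma`_0) => a b c; by case: eqP; lia.
have [q1 q2] := bigmax_intP gamma gamma`_0; rewrite gmax in q1 q2.
have [p1 p2] := bigmax_intP (mkseq (height s) k.+1) 0; rewrite -/(peak s) in p1 p2.
have peakE : peak s = - gamma`_0.
  apply/eqP; rewrite eq_le; apply/andP; split.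
    have : peak s \in mkseq (height s) k.+1.
      move: p1; rewrite inE => /orP[/eqP->|//].
      by apply/mapP; exists 0%N; rewrite ?height0// mem_iota.
    move=> /mapP[u]; rewrite mem_iota/= add0n ltnS => uk ->; rewrite hE//.
    by rewrite gerDr q2// inE mem_nth ?orbT// size_tuple.
  have : 0 \in (gamma : seq int).
    by move: q1; rewrite inE => /orP[/eqP->|//]; rewrite mem_nth// size_tuple.
  move=> /(nthP 0)[u]; rewrite size_tuple ltnS => uk gu.
  have : height s u <= peak s.
    by apply: p2; rewrite inE; apply/orP; right; apply/mapP; exists u; rewrite // mem_iota.
  by rewrite hE// gu sub0r.
split; last by rewrite hE// g0k subrr.
apply/val_inj/(@eq_from_nth _ 0); rewrite !size_tuple// => u; rewrite ltnS => uk.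
by rewrite nth_path_of_word// hE// peakE opprK subrK.
Qed.

(** Paths correspond to words of steps: a word gives back the path up to its
    level, and the condition on the maximum fixes the level. *)
Lemma GammaE : Gamma k =
  [set` [seq path_of_word s | s <- sign_words k & height s k == 0]].
Proof.
apply/seteqP; split => [gamma Gg|gamma] /=.
  have [gK h0] := @word_of_pathK gamma Gg; apply/mapP; exists (word_of_path gamma); last by rewrite gK.
  by rewrite mem_filter h0 mem_sign_words size_mkseq !eqxx.
move=> /mapP[s]; rewrite mem_filter mem_sign_words => /andP[/eqP h0 /eqP sk] ->.
exact: path_of_word_Gamma.
Qed.

Lemma sum_Gamma_1 (V : pzSemiRingType) : \sum_(gamma \in Gamma k) (1 : V) = (walks k 0)%:R.
Proof.
rewrite GammaE -fsbig_seq; last first.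
  rewrite map_inj_in_uniq ?filter_uniq ?sign_words_uniq// => s s'.
  rewrite !mem_filter !mem_sign_words => /andP[_ /eqP sk] /andP[_ /eqP s'k].
  by move=> /(congr1 word_of_path); rewrite !path_of_wordK.
by rewrite big_map big_filter -count_sign_words -sum1_count natr_sum.
Qed.

(** Each crossing of the line between i and i + 1 flips the truth value of
    j <= i, which is the same at both ends of a closed path. *)
Lemma crossings_even (i : int) (gamma : k.+1.-tuple int) :
  Gamma k gamma -> ~~ odd (crossings i gamma).
Proof.
move=> [g0k gS _].
pose Q u := (gamma`_u == i) && (gamma`_u.+1 == i + 1)
            || (gamma`_u == i + 1) && (gamma`_u.+1 == i).
have H n : (n <= k)%N ->
    odd (\sum_(0 <= u < n) Q u) = (gamma`_0 <= i) (+) (gamma`_n <= i).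
  elim: n => [|n IHn] nk; first by rewrite big_geq// addbb.
  rewrite big_nat_recr//= oddD IHn ?(ltnW nk)// -addbA; congr (_ (+) _).
  have := gS n nk; rewrite /Q.
  move: (gamma`_n) (gamma`_n.+1) => a b ab.
  by case: (leP a i); case: (leP b i) => /=; case: eqP; case: eqP; case: eqP;
    case: eqP => //=; lia.
rewrite /crossings -sum1_card (eq_bigl (fun u : 'I_k => Q u)); last first.
  by move=> u; apply/idP/idP => [/set_mem|h]; [|apply: mem_set].
by rewrite big_mkcond/= -(big_mkord xpredT (fun u => if Q u then 1 else 0)%N) (H k)// g0k addbb.
Qed.
End Gamma_count.

Lemma path_momentE (R : realType) (alpha : R) (m : nat -> R)
    (m_even : forall k, ~~ odd k -> m k = 1) (k : nat) :
  path_moment alpha m k = (alpha * k%:R + 1)^-1 * (walks k 0)%:R.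
Proof.
rewrite /path_moment; case: ifPn => [/walks_odd->|_]; first by rewrite mulr0.
congr (_ * _); rewrite -(@sum_Gamma_1 k R); apply: eq_fsbigr => gamma /set_mem Gg.
by apply: fsbig1 => i _; rewrite m_even// crossings_even.
Qed.

(** * Closed forms of the Ullman density *)

Section closed_forms.
Context {R : realType}.
Local Notation mu := (@lebesgue_measure R).

Lemma continuous_sqrt_quadratic (x : R) :
  continuous (fun t : R => Num.sqrt (4 * t ^+ 2 - x ^+ 2)).
Proof.
move=> t; apply: (@cvg_comp _ _ _ (fun t : R => 4 * t ^+ 2 - x ^+ 2) Num.sqrt);
  last exact: sqrt_continuous.
apply: cvgB; last exact: cvg_cst.
by apply: cvgM; [exact: cvg_cst|exact: exprn_continuous].
Qed.

Lemma is_derive_sqrt_quadratic (x t : R) : `|x| / 2 < t ->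
  is_derive t 1 (fun t : R => Num.sqrt (4 * t ^+ 2 - x ^+ 2))
    (4 * t / Num.sqrt (4 * t ^+ 2 - x ^+ 2)).
Proof.
move=> xt; have q0 : 0 < 4 * t ^+ 2 - x ^+ 2.
  by rewrite -[x ^+ 2]real_normK ?num_real//; have := normr_ge0 x; nra.
have d1 : is_derive t 1 (fun t : R => 4 * t ^+ 2 - x ^+ 2) (8 * t).
  rewrite (_ : (fun t => _) = 4 \*: (id ^+ 2) - cst (x ^+ 2))//.
  apply: is_derive_eq; rewrite subr0 /GRing.scale/= expr1 mulr1; ring.
have := @is_derive1_comp R Num.sqrt _ t _ _ (is_derive1_sqrt q0) d1.
move=> d2; apply: (is_derive_eq d2).
have : Num.sqrt (4 * t ^+ 2 - x ^+ 2) != 0 by rewrite gt_eqF// sqrtr_gt0.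
by move: (Num.sqrt _) => s s0; field.
Qed.

(** The integrand is infinite at t = |x| / 2 only, and has a continuous
    primitive up to that point. *)
Lemma ullman_pdf_FTC (alpha x : R) (F : R -> R) :
  0 < `|x| < 2 ->
  {within `[`|x| / 2, 1], continuous F} ->
  (forall t, `|x| / 2 < t < 1 -> is_derive t 1 F
     (t `^ (-1 + 1 / alpha) / Num.sqrt (4 * t ^+ 2 - x ^+ 2))) ->
  ullman_pdf alpha x = (1 / (alpha * pi) * (F 1 - F (`|x| / 2)))%:E.
Proof.
move=> /andP[x0 x2] cF dF; rewrite /ullman_pdf.
have x21 : `|x| / 2 < 1 by rewrite ltr_pdivrMr// mul1r.
have xI : x \in `[(-2)%R, 2%R]%classic.
  by rewrite inE/= in_itv/= -ler_norml ltW.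
pose g (t : R) := t `^ (-1 + 1 / alpha) / Num.sqrt (4 * t ^+ 2 - x ^+ 2).
have mg : measurable_fun [set: R] g.
  apply: measurable_funM; first exact: measurable_powR.
  apply: measurable_inv_sqrt; apply: measurable_funB => //.
  by apply: measurable_funM => //; exact: measurable_funX.
rewrite integral_itv_bndoo; last by apply/measurable_EFinP; exact: measurable_funTS.
rewrite indicE xI [X in (X%:E * _)%E]mul1r [RHS]EFinM; congr (_ * _)%E.
apply: (@ge0_continuous_FTC2_oo R g F) => //.
- move=> t /andP[xt t1]; have t0 : 0 < t by rewrite (le_lt_trans _ xt)// divr_ge0.
  apply: cvgM; first exact: continuous_powR_gt0.
  apply: cvgV; last exact: continuous_sqrt_quadratic.
  rewrite gt_eqF// sqrtr_gt0 -[x ^+ 2]real_normK ?num_real//; have := normr_ge0 x; nra.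
- by move=> t _; rewrite divr_ge0 ?powR_ge0 ?sqrtr_ge0.
Qed.

(** The excluded points: at 0 the density may be infinite, at 2 and -2 the
    interval of integration is a point. *)
Lemma ae_of_generic (f g : R -> \bar R) :
  (forall x : R, 2 < `|x| \/ 0 < `|x| < 2 -> f x = g x) ->
  {ae mu, forall x, f x = g x}.
Proof.
move=> fg; pose N : set R := [set 0; 2; -2].
have cN : countable N.
  by apply: finite_set_countable; rewrite /N; do 2 (rewrite finite_setU; split => //).
exists N; split; first exact: countable_measurable.
  exact: countable_lebesgue_measure0.
move=> x /= fgx; apply: contrapT => xN; apply: fgx; apply: fg.
have x0 : x != 0 by apply/eqP => x0; apply: xN; left; left.
have x2 : x != 2 by apply/eqP => x2; apply: xN; left; right.
have x2' : x != -2 by apply/eqP => x2'; apply: xN; right.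
rewrite normr_gt0 x0/=; case: (ltgtP `|x| 2) => [|?|/eqP]; [by right|by left|].
by rewrite eqr_norml (negbTE x2) (negbTE x2').
Qed.

Lemma indic_out (x : R) : 2 < `|x| -> \1_`[(-2)%R, 2%R]%classic x = 0 :> R.
Proof.
move=> x2; rewrite indicE memNset//= in_itv/= -ler_norml; apply/negP.
by rewrite -ltNge.
Qed.

Lemma indic_in (x : R) : 0 < `|x| < 2 -> \1_`[(-2)%R, 2%R]%classic x = 1 :> R.
Proof.
by move=> /andP[_ x2]; rewrite indicE mem_set//= in_itv/= -ler_norml ltW.
Qed.

Lemma ae_ullman_pdf (alpha : R) (g : R -> R) :
  (forall x : R, 0 < `|x| < 2 -> ullman_pdf alpha x = (g x)%:E) ->
  {ae mu, forall x, ullman_pdf alpha x = (\1_`[(-2)%R, 2%R]%classic x * g x)%:E}.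
Proof.
move=> fg; apply: ae_of_generic => x [x2|x02].
  by rewrite /ullman_pdf !indic_out// !mul0r mul0e.
by rewrite indic_in// mul1r fg.
Qed.

Lemma sqrt_quadratic0 (x : R) : Num.sqrt (4 * (`|x| / 2) ^+ 2 - x ^+ 2) = 0.
Proof.
rewrite expr_div_n real_normK ?num_real//.
rewrite (_ : 4 * _ - _ = 0) ?sqrtr0//; by field.
Qed.

Lemma ullman_pdf_quarter :
  {ae mu, forall x : R, ullman_pdf (1 / 4) x =
     (\1_`[-2, 2] x * ((2 + x ^+ 2) * Num.sqrt (4 - x ^+ 2) / (6 * pi)))%:E}.
Proof.
apply: ae_ullman_pdf => x x02.
pose s (t : R) := Num.sqrt (4 * t ^+ 2 - x ^+ 2).
(* From s' = 4t / s and t^2 = (s^2 + x^2) / 4, the integrand t^3 / s is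
   (s^2 s' + x^2 s') / 16. *)
pose F t := 48^-1 * s t ^+ 3 + x ^+ 2 / 16 * s t.
have cF : continuous F.
  have cs := continuous_sqrt_quadratic x.
  move=> t; apply: cvgD; apply: cvgM; try exact: cvg_cst; last exact: cs.
  apply: (@cvg_comp _ _ _ s (fun u => u ^+ 3)); first exact: cs.
  exact: exprn_continuous.
apply: etrans (@ullman_pdf_FTC (1 / 4) x F x02 _ _) _; last first.
- rewrite /F /s sqrt_quadratic0 expr1n mulr1 expr0n/= !mulr0 addr0 subr0.
  have := @sqr_sqrtr R (4 - x ^+ 2).
  have -> : 0 <= 4 - x ^+ 2.
    by rewrite -[x ^+ 2]real_normK ?num_real//; have := normr_ge0 x; nra.
  move=> /(_ isT); move: (Num.sqrt _) (pi : R) (pi_gt0 R) => q p p0 qq.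
  congr EFin; rewrite exprS qq.
  by field; rewrite gt_eqF.
- move=> t /andP[xt t1]; have d1 := is_derive_sqrt_quadratic x t xt.
  have t0 : 0 < t by rewrite (le_lt_trans _ xt)// divr_ge0.
  rewrite (_ : F = 48^-1 \*: ((s : R -> R) ^+ 3) + (x ^+ 2 / 16) \*: s); last first.
    by apply/funext => u; rewrite /F /=.
  apply: is_derive_eq.
  rewrite (_ : -1 + 1 / (1 / 4) = 3%:R :> R); last by field.
  rewrite powR_mulrn ?ltW// /GRing.scale/=.
  have : s t ^+ 2 = 4 * t ^+ 2 - x ^+ 2.
    rewrite sqr_sqrtr// -[x ^+ 2]real_normK ?num_real//; have := normr_ge0 x; nra.
  have : s t != 0.
    rewrite gt_eqF// sqrtr_gt0 -[x ^+ 2]real_normK ?num_real//; have := normr_ge0 x; nra.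
  rewrite -/(s t); move: (s t) => q q0 qq; rewrite qq.
  by field.
- exact: continuous_subspaceT.
Qed.

Lemma ullman_pdf_half :
  {ae mu, forall x : R, ullman_pdf (1 / 2) x =
     (\1_`[-2, 2] x * (1 / (2 * pi) * Num.sqrt (4 - x ^+ 2)))%:E}.
Proof.
apply: ae_ullman_pdf => x x02.
pose s (t : R) := Num.sqrt (4 * t ^+ 2 - x ^+ 2).
pose F t := 4^-1 * s t.
have cF : continuous F.
  move=> t; apply: cvgM; first exact: cvg_cst; exact: continuous_sqrt_quadratic.
apply: etrans (@ullman_pdf_FTC (1 / 2) x F x02 _ _) _; last first.
- rewrite /F /s sqrt_quadratic0 expr1n mulr1 mulr0 subr0.
  move: (Num.sqrt _) (pi : R) (pi_gt0 R) => q p p0.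
  by congr EFin; field; rewrite gt_eqF.
- move=> t /andP[xt t1]; have d1 := is_derive_sqrt_quadratic x t xt.
  have t0 : 0 < t by rewrite (le_lt_trans _ xt)// divr_ge0.
  rewrite (_ : F = 4^-1 \*: s)//.
  apply: is_derive_eq.
  rewrite (_ : -1 + 1 / (1 / 2) = 1 :> R); last by field.
  rewrite powRr1 ?ltW// /GRing.scale/= -/(s t).
  by rewrite !mulrA mulVf ?mul1r// pnatr_eq0.
- exact: continuous_subspaceT.
Qed.

Lemma ullman_pdf_one :
  {ae mu, forall x : R, ullman_pdf 1 x =
     (\1_`[-2, 2] x *
       (1 / (2 * pi) * ln ((2 + Num.sqrt (4 - x ^+ 2)) / `|x|)))%:E}.
Proof.
apply: ae_ullman_pdf => x x02; have /andP[x0 x2] := x02.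
pose s (t : R) := Num.sqrt (4 * t ^+ 2 - x ^+ 2).
have s_ge0 t : 0 <= s t by exact: sqrtr_ge0.
pose F t := 2^-1 * ln (2 * t + s t).
have dl : continuous (fun t : R => 2 * t + s t).
  move=> u; apply: cvgD; last exact: continuous_sqrt_quadratic.
  by apply: cvgM; [exact: cvg_cst|exact: cvg_id].
apply: etrans (@ullman_pdf_FTC 1 x F x02 _ _) _; last first.
- rewrite /F /s sqrt_quadratic0 expr1n !mulr1 addr0 mulrCA divff// mulr1 -mulrBr.
  rewrite -ln_div ?posrE// ?ltr_wpDr//.
  by rewrite mul1r !mulrA; congr (_ * _)%:E; rewrite mul1r div1r invfM mulrC.
- move=> t /andP[xt t1]; have d1 := is_derive_sqrt_quadratic x t xt.
  have t0 : 0 < t by rewrite (le_lt_trans _ xt)// divr_ge0.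
  have l0 : 0 < 2 * t + s t by rewrite ltr_pwDl// mulr_gt0.
  have d2 : is_derive t 1 (fun t : R => 2 * t + s t) (2 + 4 * t / s t).
    rewrite (_ : (fun t => _) = 2 \*: id + s)//.
    by apply: is_derive_eq; rewrite /GRing.scale/= mulr1.
  have d3 := @is_derive1_comp R (@ln R) _ t _ _ (is_derive1_ln l0) d2.
  rewrite (_ : F = 2^-1 \*: ((@ln R) \o (fun t : R => 2 * t + s t)))//.
  apply: is_derive_eq.
  rewrite divr1 addNr powRr0 /GRing.scale/= -/(s t).
  have : s t != 0.
    rewrite gt_eqF// sqrtr_gt0 -[x ^+ 2]real_normK ?num_real//; have := normr_ge0 x; nra.
  move: (s t) l0 => q l0 q0; field.
  by rewrite q0 gt_eqF.
- apply: continuous_in_subspaceT => t /set_mem/=; rewrite in_itv/= => /andP[xt _].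
  have t0 : 0 < t by rewrite (lt_le_trans _ xt)// divr_gt0.
  apply: cvgM; first exact: cvg_cst.
  apply: (@cvg_comp _ _ _ (fun t : R => 2 * t + s t) (@ln R)); first exact: dl.
  by apply: continuous_ln; rewrite ltr_pwDl// mulr_gt0.
Qed.
End closed_forms.

(** * Traces of powers of deterministic tridiagonal matrices *)

Section power_means.
Context {R : realType}.

(** This and the next lemma compare the increment of x^(q+1) over a unit interval
    with its derivative at the two ends; summed up, they bound a sum of
    q-th powers. *)
Lemma exprS_ge (q : nat) (x : R) : 0 <= x ->
  x ^+ q.+1 + q.+1%:R * x ^+ q <= (x + 1) ^+ q.+1.
Proof.
move=> x0; elim: q => [|q IHq]; first by rewrite !expr1 expr0 mulr1.
rewrite [leRHS]exprS (le_trans _ (ler_wpM2l _ IHq)) ?addr_ge0//.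
have := mulr_ge0 (ler0n R q.+1) (exprn_ge0 q x0).
rewrite -[q.+2%:R]natr1 (exprS x q.+1) (exprS x q).
by move: (q.+1%:R) (x ^+ q) => s y; lra.
Qed.

Lemma exprS_le (q : nat) (x : R) : 0 <= x ->
  (x + 1) ^+ q.+1 <= x ^+ q.+1 + q.+1%:R * (x + 1) ^+ q.
Proof.
move=> x0; elim: q => [|q IHq]; first by rewrite !expr1 expr0 mulr1.
rewrite [leLHS]exprS (le_trans (ler_wpM2l _ IHq)) ?addr_ge0//.
have : x ^+ q.+1 <= (x + 1) ^+ q.+1 by rewrite lerXn2r ?nnegrE// ?addr_ge0// lerDl.
rewrite -[q.+2%:R]natr1 (exprS x q.+1) (exprS (x + 1) q).
by move: (q.+1%:R) (x ^+ q.+1) ((x + 1) ^+ q) => s y z; lra.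
Qed.

Lemma power_sum_bounds (q n : nat) :
  (n%:R : R) ^+ q.+1 <= (q.+1%:R * \sum_(a < n) a.+1%:R ^+ q : R) <= (n%:R + 1 : R) ^+ q.+1.
Proof.
have H : (n%:R : R) ^+ q.+1 <= (q.+1%:R * \sum_(a < n) a.+1%:R ^+ q : R) <= (n%:R + 1 : R) ^+ q.+1 - 1.
  elim: n => [|n /andP[IH1 IH2]].
    by rewrite big_ord0 mulr0 expr0n add0r expr1n subrr lexx.
  rewrite big_ord_recr/= mulrDr -natr1.
  have h1 := @exprS_le q n%:R (ler0n _ _).
  have h2 := @exprS_ge q (n%:R + 1) (addr_ge0 (ler0n _ _) ler01).
  by apply/andP; split; lra.
by case/andP: H => H1 H2; rewrite H1/= (le_trans H2)// gerBl.
Qed.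

Lemma cvg_power_mean (q : nat) :
  n%:R^-1 * \sum_(a < n) (a.+1%:R / n%:R) ^+ q @[n --> \oo] --> (q.+1%:R^-1 : R).
Proof.
have c0 : 1 + n%:R^-1 @[n --> \oo] --> (1 + 0 : R).
  apply: cvgD; first exact: cvg_cst.
  by apply/gtr0_cvgV0; [near=> n; rewrite ltr0n; near: n; exact: nbhs_infty_gt|exact: cvgr_idn].
rewrite addr0 in c0.
have c1 : (1 + n%:R^-1) ^+ q.+1 / q.+1%:R @[n --> \oo] --> (1 ^+ q.+1 / q.+1%:R : R).
  apply: cvgM; last exact: cvg_cst.
  apply: (@cvg_comp _ _ _ (fun n : nat => 1 + n%:R^-1 : R) (fun x => x ^+ q.+1) _ _ _ c0).
  exact: exprn_continuous.
rewrite expr1n mul1r in c1.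
apply: (@squeeze_cvgr _ _ _ _ (cst q.+1%:R^-1) (fun n => (1 + n%:R^-1) ^+ q.+1 / q.+1%:R)) => //;
  last exact: cvg_cst.
near=> n.
have n0 : (0 < n)%N by near: n; exact: nbhs_infty_gt.
have n0' : 0 < n%:R :> R by rewrite ltr0n.
have /andP[h1 h2] := power_sum_bounds q n.
have -> : n%:R^-1 * \sum_(a < n) (a.+1%:R / n%:R) ^+ q =
    (\sum_(a < n) a.+1%:R ^+ q) / n%:R ^+ q.+1 :> R.
  under eq_bigr do rewrite expr_div_n.
  by rewrite -mulr_suml exprS invfM mulrC -mulrA (mulrC (_ ^- _)).
have nq : 0 < n%:R ^+ q.+1 :> R by rewrite exprn_gt0.
apply/andP; split.
  by rewrite ler_pdivlMr// mulrC ler_pdivrMr// mulrC.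
rewrite ler_pdivrMr// mulrAC ler_pdivlMr// mulrC -exprMn mulrDl mul1r mulVf ?gt_eqF//.
Unshelve. all: by end_near. Qed.

End power_means.

Section matrix_powers.
Context {R : realType}.
Implicit Types d b : nat -> R.

(** Formal entry at distance r from the diagonal, in the row carrying d_a, of the
    k-th power of a tridiagonal matrix without corners: a sum over walks, where
    a stay at the row carrying d_c weighs d_c, and a step between the
    neighbouring rows carrying d_c and d_(c+1) weighs b_c. The column at
    distance r carries d_(a+r). *)
Fixpoint walk_weight d b (k : nat) (a r : int) : R :=
  if k is k'.+1 then
    walk_weight d b k' a r * d (absz (a + r)%R) +
    walk_weight d b k' a (r + 1) * b (absz (a + r)%R) +
    walk_weight d b k' a (r - 1) * b (absz (a + r - 1)%R)
  else (r == 0)%:R.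

Lemma walk_weight_far d b k a r : (k < `|r|)%N -> walk_weight d b k a r = 0.
Proof.
elim: k r => [|k IHk] r kr /=; first by case: eqP => //; lia.
by rewrite !IHk ?mul0r ?addr0//; lia.
Qed.

Lemma sum_ord_eq (n x : nat) (F : nat -> R) :
  \sum_(l < n) (if (l : nat) == x then F l else 0) = if (x < n)%N then F x else 0.
Proof. by rewrite -big_mkcond/= big_ord1_eq. Qed.

(** The form in which a sum over l collapses to the three neighbours of j. In the
    first column there is no neighbour j - 1, although j.-1 makes sense. *)
Lemma beta_matrixE d b n (l j : 'I_n) : beta_matrix d b n l j =
  (if (l : nat) == j then d (n - j)%N else 0) +
  (if (l : nat) == j.-1 then (if (0 < j)%N then b (n - j)%N else 0) else 0) +
  (if (l : nat) == j.+1 then b (n - j.+1)%N else 0).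
Proof.
rewrite mxE -val_eqE/=; case: (eqVneq (l : nat) j) => [lj|lj].
  rewrite lj (_ : (j == j.+1 :> nat) = false) ?addr0; last by lia.
  case: (posnP j) => j0; rewrite ?j0 ?eqxx ?addr0//.
  by rewrite (_ : (j == j.-1 :> nat) = false) ?addr0//; lia.
case: (eqVneq (j : nat) l.+1) => [jl|jl].
  by rewrite jl /= eqxx (_ : (l == l.+2 :> nat) = false) ?add0r ?addr0//; lia.
case: (eqVneq (l : nat) j.+1) => [lj'|lj'].
  rewrite lj' (_ : (j.+1 == j.-1 :> nat) = false) ?add0r//; lia.
case: eqP => [h|_]; rewrite ?addr0//.
by rewrite (_ : (0 < j)%N = false) ?addr0//; lia.
Qed.

(** A walk of length k from row i cannot leave the matrix when i is at distance at
    least k from both corners. *)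
Lemma beta_matrix_pow d b n k (i j : 'I_n) : (k <= i)%N -> (i + k < n)%N ->
  (beta_matrix d b n ^+ k) i j = walk_weight d b k (n%:Z - i%:Z) (i%:Z - j%:Z).
Proof.
elim: k j => [|k IHk] j ki kn.
  rewrite expr0 mxE /=; congr (nat_of_bool _)%:R; apply/eqP/eqP => [->|]; first by lia.
  by move=> h; apply/val_inj => /=; lia.
have IH l : (beta_matrix d b n ^+ k) i l = walk_weight d b k (n%:Z - i%:Z) (i%:Z - l%:Z).
  by apply: IHk; lia.
rewrite exprSr -mulmxE mxE.
set W := walk_weight d b k (n%:Z - i%:Z) in IH.
under eq_bigr => l _ do rewrite IH beta_matrixE !mulrDr.
rewrite !big_split/=.
rewrite (eq_bigr (fun l : 'I_n => if (l : nat) == j then W (i%:Z - l%:Z) * d (n - j)%N else 0));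
  last by move=> l _; case: ifP; rewrite ?mulr0.
rewrite [X in _ + X + _](eq_bigr (fun l : 'I_n => if (l : nat) == j.-1 then
    W (i%:Z - l%:Z) * (if (0 < j)%N then b (n - j)%N else 0) else 0));
  last by move=> l _; case: ifP; rewrite ?mulr0.
rewrite [X in _ + X](eq_bigr (fun l : 'I_n => if (l : nat) == j.+1 then
    W (i%:Z - l%:Z) * b (n - j.+1)%N else 0));
  last by move=> l _; case: ifP; rewrite ?mulr0.
rewrite (sum_ord_eq n j (fun l => W (i%:Z - l%:Z) * d (n - j)%N)).
rewrite (sum_ord_eq n j.-1 (fun l => W (i%:Z - l%:Z) * (if (0 < j)%N then b (n - j)%N else 0))).
rewrite (sum_ord_eq n j.+1 (fun l => W (i%:Z - l%:Z) * b (n - j.+1)%N)).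
have jn := ltn_ord j.
rewrite jn (leq_ltn_trans (leq_pred j) jn) -/W.
congr (_ + _ + _).
- by congr (W _ * d _); lia.
- case: (posnP j) => j0; last by congr (W _ * b _); lia.
  by rewrite mulr0 /W walk_weight_far ?mul0r//; lia.
- case: ltnP => jn'; first by congr (W _ * b _); lia.
  by rewrite /W walk_weight_far ?mul0r//; lia.
Qed.

Lemma scaled_beta_matrix_pow d b n k :
  scaled_beta_matrix d b n ^+ k =
  (Num.sqrt n%:R)^-1 ^+ k *: beta_matrix d b n ^+ k.
Proof.
elim: k => [|k IHk]; first by rewrite !expr0 scale1r.
rewrite !exprS IHk -!mulmxE /scaled_beta_matrix -scalemxAl -scalemxAr scalerA.
by rewrite mulrC.
Qed.

Lemma sum_ord_eq_le (n x : nat) (y : R) : 0 <= y ->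
  \sum_(l < n) (if (l : nat) == x then y else 0) <= y.
Proof. by move=> y0; rewrite (sum_ord_eq n x (fun=> y)); case: ifP. Qed.

Lemma scaled_beta_matrix_pow_le d b n k (D : R) (i j : 'I_n) :
  (forall i j, `|scaled_beta_matrix d b n i j| <= D) ->
  `|(scaled_beta_matrix d b n ^+ k) i j| <= (3 * D) ^+ k.
Proof.
move=> XD; have D0 : 0 <= D by rewrite (le_trans _ (XD i i)).
elim: k j => [|k IHk] j.
  by rewrite !expr0 mxE; case: (i == j); rewrite ?normr0 ?normr1.
rewrite exprSr -mulmxE mxE (le_trans (ler_norm_sum _ _ _))//.
pose y := (3 * D) ^+ k * D.
have y0 : 0 <= y by rewrite mulr_ge0// exprn_ge0// mulr_ge0.
rewrite (_ : _ ^+ k.+1 = y + y + y); last by rewrite exprSr /y; ring.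
rewrite (@le_trans _ _ (\sum_(l < n) ((if (l : nat) == j then y else 0) +
   (if (l : nat) == j.-1 then y else 0) + (if (l : nat) == j.+1 then y else 0))))//.
  apply: ler_sum => l _; rewrite normrM.
  have y00 (c : bool) : 0 <= if c then y else 0 by case: c.
  have h : `|(scaled_beta_matrix d b n ^+ k) i l| * `|scaled_beta_matrix d b n l j| <= y.
    by rewrite ler_pM.
  case: (eqVneq (l : nat) j) => [_|lj]; first by rewrite (le_trans h)// -addrA lerDl addr_ge0.
  case: (eqVneq (l : nat) j.-1) => [_|lj1]; first by rewrite (le_trans h)// add0r lerDl.
  case: (eqVneq (l : nat) j.+1) => [_|lj2]; first by rewrite (le_trans h)// !add0r.
  by rewrite mxE beta_matrixE (negbTE lj) (negbTE lj1) (negbTE lj2) !addr0 mulr0 normr0 mulr0.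
by rewrite !big_split/= !lerD// sum_ord_eq_le.
Qed.

Lemma cvg_sqrt_shift (u : nat -> R) (l : R) (r : int) :
  u n / Num.sqrt n%:R @[n --> \oo] --> l ->
  u (absz (n%:Z + r)%R) / Num.sqrt n%:R @[n --> \oo] --> l.
Proof.
move=> ul; pose f n := (absz (n%:Z + r)%R).
have foo : f n @[n --> \oo] --> \oo.
  apply/cvgnyPge => A; near=> n.
  have : (A + `|r| <= n)%N by near: n; exact: nbhs_infty_ge.
  by rewrite /f; lia.
have c1 : u (f n) / Num.sqrt (f n)%:R @[n --> \oo] --> l by exact: (cvg_comp _ _ foo ul).
have c2 : (1 + r%:~R / n%:R) @[n --> \oo] --> (1 + r%:~R * 0 : R).
  apply: cvgD; first exact: cvg_cst.
  apply: cvgM; first exact: cvg_cst.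
  by apply/gtr0_cvgV0; [near=> n; rewrite ltr0n; near: n; exact: nbhs_infty_gt|exact: cvgr_idn].
rewrite mulr0 addr0 in c2.
have c3 : Num.sqrt (1 + r%:~R / n%:R) @[n --> \oo] --> (Num.sqrt 1 : R).
  exact: (cvg_comp _ _ c2 (@sqrt_continuous _ _)).
rewrite sqrtr1 in c3.
have c4 : u (f n) / Num.sqrt (f n)%:R * Num.sqrt (1 + r%:~R / n%:R) @[n --> \oo] -->
  l * 1 by exact: cvgM.
rewrite -[l]mulr1; apply: cvg_trans c4; apply: near_eq_cvg.
near=> n.
have rn : (absz r < n)%N by near: n; exact: nbhs_infty_gt.
have n0 : 0 < n%:R :> R by rewrite ltr0n; lia.
have fE : (f n)%:R = n%:R + r%:~R :> R.
  by rewrite natr_absz ger0_norm; [rewrite intrD|lia].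
have f0 : 0 < (f n)%:R :> R by rewrite ltr0n /f; lia.
have -> : 1 + r%:~R / n%:R = (f n)%:R / n%:R :> R.
  by rewrite fE mulrDl divff ?gt_eqF.
rewrite sqrtrM ?ler0n// sqrtrV ?ler0n// /=.
have : Num.sqrt (f n)%:R != 0 :> R by rewrite gt_eqF// sqrtr_gt0.
have : Num.sqrt n%:R != 0 :> R by rewrite gt_eqF// sqrtr_gt0.
rewrite -/(f n); move: (Num.sqrt _) (Num.sqrt _) (u _) => x y z x0 y0.
by field; rewrite x0 y0.
Unshelve. all: by end_near. Qed.

(** In the limit the stays weigh 0 and the steps weigh 1, so that the recursion
    of [walk_weight] becomes that of [walks]. *)
Lemma cvg_walk_weight d b k r :
  d n / Num.sqrt n%:R @[n --> \oo] --> (0 : R) ->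
  b n / Num.sqrt n%:R @[n --> \oo] --> (1 : R) ->
  walk_weight d b k n%:Z r / Num.sqrt n%:R ^+ k @[n --> \oo] --> ((walks k r)%:R : R).
Proof.
move=> d0 b1; elim: k r => [|k IHk] r.
  rewrite /= (_ : (fun n => _) = cst ((r == 0)%:R)); first exact: cvg_cst.
  by apply/funext => n; rewrite expr0 divr1.
have -> : (fun n : nat => walk_weight d b k.+1 n%:Z r / Num.sqrt n%:R ^+ k.+1) =
  (fun n : nat => walk_weight d b k n%:Z r / Num.sqrt n%:R ^+ k *
               (d (absz (n%:Z + r)%R) / Num.sqrt n%:R) +
               walk_weight d b k n%:Z (r + 1) / Num.sqrt n%:R ^+ k *
               (b (absz (n%:Z + r)%R) / Num.sqrt n%:R) +
               walk_weight d b k n%:Z (r - 1) / Num.sqrt n%:R ^+ k *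
               (b (absz (n%:Z + (r - 1))%R) / Num.sqrt n%:R)).
  by apply/funext => n; rewrite /= exprSr invfM addrA; ring.
rewrite (_ : (walks k.+1 r)%:R = (walks k r)%:R * 0 + (walks k (r + 1))%:R * 1 +
  (walks k (r - 1))%:R * 1 :> R); last first.
  by rewrite /= natrD mulr0 add0r !mulr1 addrC.
by apply: cvgD; [apply: cvgD|]; apply: cvgM; try exact: IHk; exact: cvg_sqrt_shift.
Qed.

End matrix_powers.

Section trace.
Context {R : realType}.
Implicit Types d b : nat -> R.

Lemma cvg_bounded (u : nat -> R) (l : R) : u n @[n --> \oo] --> l ->
  exists D : R, forall n, `|u n| <= D.
Proof.
move=> ul; have /cvg_seq_bounded[M [_ MP]] : cvgn u by apply/cvg_ex; exists l.
by exists (M + 1) => n; apply: MP => //; rewrite ltrDl.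
Qed.

Lemma scaled_entry_le d b (D : R) n :
  (forall p, (0 < p)%N -> `|d p| / Num.sqrt p%:R <= D) ->
  (forall p, (0 < p)%N -> `|b p| / Num.sqrt p%:R <= D) ->
  forall i j : 'I_n, `|scaled_beta_matrix d b n i j| <= D.
Proof.
move=> dD bD i j; have D0 : 0 <= D by rewrite (le_trans _ (dD 1 _))// divr_ge0.
have H (u : nat -> R) p : (forall p, (0 < p)%N -> `|u p| / Num.sqrt p%:R <= D) ->
    (0 < p <= n)%N -> `|(Num.sqrt n%:R)^-1 * u p| <= D.
  move=> uD /andP[p0 pn]; rewrite normrM ger0_norm ?invr_ge0// mulrC.
  rewrite (le_trans _ (uD p p0))// ler_wpM2l// lef_pV2 ?posrE ?sqrtr_gt0 ?ltr0n//; last by lia.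
  by rewrite ler_wsqrtr// ler_nat.
have ni := ltn_ord i; have nj := ltn_ord j.
rewrite mxE mxE; case: ifP => _; first by apply: H => //; lia.
case: ifP => [/eqP ji|_]; first by apply: H => //; lia.
case: ifP => [/eqP ij|_]; first by apply: H => //; lia.
by rewrite mulr0 normr0.
Qed.

Lemma sum_lt_nat (n k : nat) : (\sum_(a < n) (a < k) <= k)%N.
Proof.
suff -> : (\sum_(a < n) (a < k) = minn n k)%N by rewrite geq_minr.
elim: n => [|n IHn]; first by rewrite big_ord0 min0n.
by rewrite big_ord_recr/= IHn; case: (ltnP n k); lia.
Qed.

Lemma sum_ge_nat (n k : nat) : (\sum_(a < n) (n <= a + k) <= k)%N.
Proof.
rewrite (reindex_inj rev_ord_inj)/= (leq_trans _ (sum_lt_nat n k))//.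
by apply: leq_sum => a _; have := ltn_ord a; lia.
Qed.

(** Numbering rows by a, the index of their diagonal entry, the entry of row a in
    the middle differs from (a/n)^(k/2) [walks k 0] by at most the deviation of
    [walk_weight] from its limit, whose mean over a tends to 0 by Cesaro's
    theorem. The at most k rows at each corner are bounded and so do not
    matter. *)
Lemma cvg_normalized_trace d b k :
  d n / Num.sqrt n%:R @[n --> \oo] --> (0 : R) ->
  b n / Num.sqrt n%:R @[n --> \oo] --> (1 : R) ->
  normalized_trace (scaled_beta_matrix d b n ^+ k) @[n --> \oo] -->
  ((1 / 2 * k%:R + 1)^-1 * (walks k 0)%:R : R).
Proof.
move=> d0 b1; pose w : R := (walks k 0)%:R.
have w0 : 0 <= w by exact: ler0n.
have [Dd dD] := cvg_bounded _ _ d0; have [Db bD] := cvg_bounded _ _ b1.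
pose D := Num.max Dd Db.
have D0 : 0 <= D by rewrite le_max (le_trans _ (dD 0%N)).
have XD n (i j : 'I_n) : `|scaled_beta_matrix d b n i j| <= D.
  have E (u : nat -> R) p : `|u p| / Num.sqrt p%:R = `|u p / Num.sqrt p%:R|.
    by rewrite normrM [X in _ = _ * X]ger0_norm// invr_ge0.
  by apply: scaled_entry_le => p _; rewrite E le_max ?dD ?bD ?orbT.
pose B := (3 * D) ^+ k + w.
have B0 : 0 <= B by rewrite addr_ge0// exprn_ge0// mulr_ge0.
pose v a : R := `|walk_weight d b k a%:Z 0 / Num.sqrt a%:R ^+ k - w|.
have v0 : v a @[a --> \oo] --> (0 : R).
  rewrite -(@normr0 _ R); apply: cvg_norm; rewrite -(subrr w).
  by apply: cvgB; [exact: cvg_walk_weight|exact: cvg_cst].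
pose main n : R := n%:R^-1 * \sum_(a < n) (Num.sqrt (a.+1%:R / n%:R) ^+ k * w).
pose err n : R := n%:R^-1 * \sum_(a < n) v a.+1 + n%:R^-1 * (2 * k%:R * B).
have diff n : `|normalized_trace (scaled_beta_matrix d b n ^+ k) - main n| <= err n.
  rewrite /normalized_trace /mxtrace (reindex_inj rev_ord_inj)/= /main -mulrBr -sumrB.
  rewrite normrM ger0_norm ?invr_ge0// /err -mulrDr ler_wpM2l ?invr_ge0//.
  rewrite (le_trans (ler_norm_sum _ _ _))//.
  apply: (@le_trans _ _ (\sum_(a < n) (v a.+1 + B * (a < k)%:R + B * (n <= a + k)%:R))).
    apply: ler_sum => a _; have an := ltn_ord a.
    have n0 : 0 < n%:R :> R by rewrite ltr0n; lia.
    have s1 : 0 <= Num.sqrt (a.+1%:R / n%:R : R) <= 1.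
      rewrite sqrtr_ge0 -[leRHS]sqrtr1 ler_wsqrtr// ler_pdivrMr// mul1r ler_nat//.
    have crude : `|(scaled_beta_matrix d b n ^+ k) (rev_ord a) (rev_ord a) -
        Num.sqrt (a.+1%:R / n%:R) ^+ k * w| <= B.
      rewrite (le_trans (ler_normB _ _))// lerD//.
        exact: scaled_beta_matrix_pow_le.
      case/andP: s1 => s0 s1.
      by rewrite ger0_norm ?mulr_ge0 ?exprn_ge0// ler_piMl// exprn_ile1.
    have va : 0 <= v a.+1 by exact: normr_ge0.
    case: (ltnP a k) => ak.
      by rewrite (le_trans crude)// mulr1 addrAC lerDr addr_ge0// mulr_ge0.
    case: (leqP n (a + k)) => nak.
      by rewrite (le_trans crude)// mulr1 mulr0 addr0 lerDr.
    rewrite !mulr0 !addr0 scaled_beta_matrix_pow mxE beta_matrix_pow/=; last 2 first.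
    - by lia.
    - by lia.
    rewrite subrr (_ : n%:Z - (n - a.+1)%N%:Z = a.+1%:Z); last by lia.
    have sa0 : Num.sqrt a.+1%:R != 0 :> R by rewrite gt_eqF// sqrtr_gt0.
    have -> : (Num.sqrt n%:R)^-1 ^+ k * walk_weight d b k a.+1 0 =
      Num.sqrt (a.+1%:R / n%:R) ^+ k * (walk_weight d b k a.+1%:Z 0 / Num.sqrt a.+1%:R ^+ k).
      rewrite sqrtrM// sqrtrV// exprMn [X in _ = X * _]mulrC -mulrA; congr (_ * _).
      by rewrite mulrCA divff ?mulr1// expf_neq0.
    rewrite -mulrBr normrM -[leRHS]mul1r ler_pM//; case/andP: s1 => s0 s1.
    by rewrite ger0_norm ?exprn_ge0// exprn_ile1.
  rewrite !big_split/= -addrA lerD2l -!mulr_sumr -mulrDr mulrC ler_wpM2r//.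
  rewrite -!natr_sum -natrD -natrM ler_nat.
  by rewrite mul2n -addnn leq_add ?sum_lt_nat ?sum_ge_nat.
have err0 : err n @[n --> \oo] --> (0 : R).
  rewrite -(addr0 0); apply: cvgD.
    have v0' : v a.+1 @[a --> \oo] --> (0 : R) by rewrite (cvg_shiftS v).
    have := cesaro v0'; rewrite -(cvg_shiftS (fun n => n%:R^-1 * \sum_(a < n) v a.+1)).
    by rewrite /arithmetic_mean/= /series/=; under eq_fun do rewrite big_mkord.
  rewrite -(mul0r (2 * k%:R * B)); apply: cvgM; last exact: cvg_cst.
  by apply/gtr0_cvgV0; [near=> n; rewrite ltr0n; near: n; exact: nbhs_infty_gt|exact: cvgr_idn].
have mainw : main n @[n --> \oo] --> ((1 / 2 * k%:R + 1)^-1 * w : R).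
  have [ok|ek] := boolP (odd k).
    rewrite /main /w walks_odd// mulr0.
    under eq_fun => n do under eq_bigr do rewrite mulr0.
    under eq_fun => n do rewrite big1// mulr0.
    exact: cvg_cst.
  have kE : k = (k./2 * 2)%N by rewrite muln2 even_halfK.
  have -> : (1 / 2 * k%:R + 1)^-1 = k./2.+1%:R^-1 :> R.
    by rewrite {1}kE natrM -natr1; congr (_^-1); field.
  have -> : main = (fun n => (n%:R^-1 * \sum_(a < n) (a.+1%:R / n%:R) ^+ k./2) * w).
    apply/funext => n; rewrite /main -mulr_suml mulrA; congr (_ * _ * _).
    apply: eq_bigr => a _; rewrite {1}kE mulnC exprM sqr_sqrtr// divr_ge0//.
  by apply: cvgM; [exact: cvg_power_mean|exact: cvg_cst].
rewrite -[X in _ --> X]addr0.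
have c : main n + (normalized_trace (scaled_beta_matrix d b n ^+ k) - main n) @[n --> \oo] -->
   ((1 / 2 * k%:R + 1)^-1 * w + 0 : R).
  apply: cvgD => //; apply/norm_cvg0P.
  apply: (@squeeze_cvgr _ _ _ _ (cst 0) err) => //; last exact: cvg_cst.
  by near=> n; rewrite normr_ge0 diff.
apply: cvg_trans c; apply: near_eq_cvg; near=> n; by rewrite addrC subrK.
Unshelve. all: by end_near. Qed.
End trace.

(** * Integration against a density *)

Section densities.
Context {R : realType}.
Local Notation mu := (@lebesgue_measure R).
Local Notation T := (measurableTypeR R).

Import HBNNSimple.

(** Holds for indicator functions by assumption, hence for simple functions, and
    passes to increasing limits. *)
Lemma ge0_integral_density (m : {measure set T -> \bar R}) (f : R -> R)
    (g : R -> \bar R) :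
  measurable_fun [set: R] f -> (forall x, 0 <= f x) ->
  (forall A : set R, measurable A -> m A = \int[mu]_(x in A) (f x)%:E)%E ->
  measurable_fun [set: R] g -> (forall x, 0 <= g x)%E ->
  (\int[m]_x g x = \int[mu]_x (g x * (f x)%:E))%E.
Proof.
move=> mf f0 mE mg g0.
have mEf D : measurable_fun D (EFin \o f).
  by apply/measurable_EFinP; exact: measurable_funTS.
pose h := nnsfun_approx (@measurableT _ T) mg.
have hcvg x : (h n x)%:E @[n --> \oo] --> g x by exact: cvg_nnsfun_approx.
have indicI (A : set R) : measurable A ->
    (\int[m]_x (\1_A x)%:E = \int[mu]_x ((\1_A x)%:E * (f x)%:E))%E.
  move=> mA; rewrite integral_indic// setIT mE// integral_mkcond.
  apply: eq_integral => x _; rewrite patchE indicE.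
  by case: ifPn => _; rewrite ?mul1e ?mul0e.
have simpleI (s : {nnsfun T >-> R}) :
    (\int[m]_x (s x)%:E = \int[mu]_x ((s x)%:E * (f x)%:E))%E.
  under [LHS]eq_integral do rewrite fimfunE -fsumEFin//.
  rewrite [LHS]ge0_integral_fsum//; last 2 first.
  - by move=> r; exact/measurable_EFinP/measurableT_comp.
  - by move=> n x _; rewrite EFinM nnfun_muleindic_ge0.
  under [RHS]eq_integral.
    move=> x xD; rewrite fimfunE -fsumEFin// ge0_mule_fsuml; last first.
      by move=> r; rewrite EFinM nnfun_muleindic_ge0.
    over.
  rewrite [RHS]ge0_integral_fsum//; last 2 first.
  - move=> r; apply: emeasurable_funM; last exact: mEf.
    by apply/measurable_EFinP; exact: measurableT_comp.
  - move=> n x _; apply: mule_ge0; last by rewrite lee_fin.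
    by rewrite EFinM nnfun_muleindic_ge0.
  apply: eq_fsbigr => r _.
  have [r0|r0] := leP 0 r; last first.
    rewrite !integral0_eq// => x _; rewrite indicE preimage_nnfun0//.
      by rewrite in_set0 mulr0 mul0e.
    by rewrite in_set0 mulr0.
  under eq_integral do rewrite EFinM.
  under [RHS]eq_integral do rewrite EFinM -muleA.
  rewrite !ge0_integralZl_EFin//.
  - congr (_ * _)%E; apply: indicI; rewrite -[X in measurable X]setTI.
    by apply: (@measurable_funPT _ _ _ _ s) => //; exact: measurable_set1.
  - by move=> x _; rewrite mule_ge0 ?lee_fin.
  - apply: emeasurable_funM; last exact: mEf.
    by apply/measurable_EFinP; exact: measurable_indic.
  - by apply/measurable_EFinP; exact: measurable_indic.
transitivity (limn (fun n => \int[m]_x (h n x)%:E))%E.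
  rewrite -monotone_convergence//.
  - by apply: eq_integral => x _; apply/esym/cvg_lim.
  - by move=> n; exact/measurable_EFinP.
  - by move=> n x _; rewrite lee_fin.
  - by move=> x _ a b ab; rewrite lee_fin; exact/lefP/nd_nnsfun_approx.
transitivity (limn (fun n => \int[mu]_x ((h n x)%:E * (f x)%:E)))%E.
  by congr (limn _); apply/funext => n; exact: simpleI.
rewrite -monotone_convergence//.
- apply: eq_integral => x _; apply/cvg_lim => //.
  by apply: cvgeZr => //; exact: hcvg.
- by move=> n; apply: emeasurable_funM => //; exact/measurable_EFinP.
- by move=> n x _; rewrite mule_ge0// lee_fin.
- move=> x _ a b ab; rewrite lee_wpmul2r ?lee_fin//.
  exact/lefP/nd_nnsfun_approx.
Qed.

Lemma has_law_integral d (Omega : measurableType d) (P : probability Omega R)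
    (X : Omega -> R) (m : {measure set T -> \bar R}) (g : R -> \bar R) :
  measurable_fun [set: Omega] X -> has_law P X m ->
  measurable_fun [set: R] g -> (forall x, 0 <= g x)%E ->
  (\int[P]_w g (X w) = \int[m]_x g x)%E.
Proof.
move=> mX lawX mg g0.
have mX' : @measurable_fun _ _ Omega T [set: Omega] X := mX.
have := @ge0_integral_pushforward _ _ Omega T R X mX' P setT g measurableT mg
  (fun y _ => g0 y).
rewrite preimage_setT => <-.
apply: (@eq_measure_integral _ T R setT m
  (measure_function_pushforward__canonical__measure_function_Measure P mX')).
by move=> A mA _; exact: lawX.
Qed.

(** The semicircle law is the Ullman law with alpha = 1/2. *)
Lemma semicircle_moment (k : nat) :
  \int[@semicircle R]_x x ^+ k = (1 / 2 * k%:R + 1)^-1 * (walks k 0)%:R.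
Proof.
have h0 : 0 < 1 / 2 :> R by lra.
have [_ E] := ullman_moment (1 / 2) h0 k.
rewrite /Rintegral -[RHS]/(fine _%:E) -E; congr fine.
apply: eq_measure_integral => A mA _; rewrite /ullman/semicircle/= /density_measure.
have [N [mN N0 sN]] := @ullman_pdf_half R.
apply/esym; apply: ae_eq_integral => //.
- by apply: measurable_funTS; exact: measurable_ullman_pdf.
- by apply: measurable_funTS; exact: measurable_semicircle_pdf.
exists N; split=> // x /= h; apply: sN => /= xE; apply: h => _; exact: xE.
Qed.

Lemma pow_le_expR (q : nat) (y : R) : 0 <= y -> y ^+ q <= q`!%:R * expR y.
Proof.
move=> y0; case: q => [|q].
  by rewrite expr0 fact0 mul1r (le_trans _ (expR_ge1Dx y))// lerDl.
rewrite mulrC -ler_pdivrMr ?ltr0n ?fact_gt0//.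
by rewrite (le_trans _ (expR_ge1Dxn q y0))// lerDr.
Qed.

(** A power of x^2 is absorbed by expR (x^2 / 8), which leaves a multiple of the
    normal density of variance 4. *)
Lemma normal_even_moment_lty (q : nat) :
  (\int[normal_prob 0 (Num.sqrt 2)]_x (x ^+ (2 * q))%:E < +oo :> \bar R)%E.
Proof.
have s0 : Num.sqrt 2 != 0 :> R by rewrite gt_eqF// sqrtr_gt0.
have mX : measurable_fun [set: R] (fun x : R => (x ^+ (2 * q))%:E).
  by apply/measurable_EFinP; exact: measurable_funX.
have X0 (x : R) : 0 <= x ^+ (2 * q) by rewrite exprM exprn_ge0// sqr_ge0.
have X0' (x : R) : (0 <= (x ^+ (2 * q))%:E)%E by rewrite lee_fin.
rewrite (@ge0_integral_density (normal_prob 0 (Num.sqrt 2)) (normal_pdf 0 (Num.sqrt 2))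
  _ (measurable_normal_pdf _ _) (normal_pdf_ge0 _ _) (fun _ _ => erefl) mX X0').
pose C : R := 8 ^+ q * q`!%:R * (normal_peak (Num.sqrt 2) / normal_peak 2).
have C0 : 0 <= C by rewrite /C !mulr_ge0 ?exprn_ge0 ?invr_ge0 ?normal_peak_ge0 ?ler0n.
apply: (@le_lt_trans _ _ (\int[mu]_x (C%:E * (normal_pdf 0 2 x)%:E))%E); last first.
  rewrite ge0_integralZl_EFin//.
  - by rewrite integral_normal_pdf mule1 ltry.
  - by move=> x _; rewrite lee_fin normal_pdf_ge0.
  - by apply/measurable_EFinP; exact: measurable_normal_pdf.
apply: ge0_le_integral => //.
- by move=> x _; rewrite mule_ge0 ?lee_fin// normal_pdf_ge0.
- apply: emeasurable_funM => //; apply/measurable_EFinP; exact: measurable_normal_pdf.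
- apply: emeasurable_funM => //; apply/measurable_EFinP; exact: measurable_normal_pdf.
move=> x _; rewrite -!EFinM lee_fin !normal_pdfE// /= /normal_fun !subr0.
rewrite sqr_sqrtr//.
have p2 : normal_peak 2 != 0 :> R by rewrite gt_eqF// normal_peak_gt0.
pose y := x ^+ 2 / 8.
have y0 : 0 <= y by rewrite divr_ge0// sqr_ge0.
have xq : x ^+ (2 * q) = 8 ^+ q * y ^+ q by rewrite exprM -exprMn; congr (_ ^+ q); rewrite /y; field.
have yq := pow_le_expR q y y0.
have e4 : expR (- x ^+ 2 / (2 *+ 2)) = expR (- y) * expR (- y).
  by rewrite -expRD; congr expR; rewrite /y; field.
have e8 : expR (- x ^+ 2 / (2 ^+ 2 *+ 2)) = expR (- y).
  by congr expR; rewrite /y; field.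
rewrite e4 e8 xq /C.
have eK : expR y * expR (- y) = 1 by rewrite -expRD subrr expR0.
set P1 := normal_peak _; set P2 := normal_peak 2 in p2 *.
have P10 : 0 <= P1 by exact: normal_peak_ge0.
have ey0 := expR_ge0 (- y).
rewrite (_ : 8 ^+ q * q`!%:R * (P1 / P2) * (P2 * expR (- y)) =
   8 ^+ q * P1 * expR (- y) * (q`!%:R)); last by field.
rewrite (_ : 8 ^+ q * y ^+ q * (P1 * (expR (- y) * expR (- y))) =
   8 ^+ q * P1 * expR (- y) * (y ^+ q * expR (- y))); last by ring.
rewrite ler_wpM2l// ?mulr_ge0//.
rewrite (le_trans (ler_wpM2r ey0 yq))// -mulrA eK mulr1//.
Qed.

End densities.

(** * Moments of the chi law *)

Section chi.
Context {R : realType}.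
Local Notation mu := (@lebesgue_measure R).
Local Notation T := (measurableTypeR R).

Lemma is_derive_chi_primitive (a x : R) : 0 < x ->
  is_derive x 1 (fun x : R => x `^ a * expR (- x ^+ 2 / 2))
    (a * (x `^ (a - 1) * expR (- x ^+ 2 / 2)) -
     x `^ (a + 1) * expR (- x ^+ 2 / 2)).
Proof.
move=> x0; have d1 := is_derive1_powR a x0.
have d2 : is_derive x 1 (fun x : R => - x ^+ 2 / 2) (- x).
  rewrite (_ : (fun x => _) = (- 2^-1) \*: (id ^+ 2)); last first.
    by apply/funext => y /=; rewrite {1}/GRing.scale/= mulNr mulrC mulNr.
  by apply: is_derive_eq; rewrite /GRing.scale/= expr1 mulr1; field.
have d3 := @is_derive1_comp R expR _ x _ _ (is_derive_expR _) d2.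
have -> : (fun x : R => x `^ a * expR (- x ^+ 2 / 2)) =
  (@powR R ^~ a) * (expR \o (fun x : R => - x ^+ 2 / 2)) by [].
apply: is_derive_eq; rewrite /GRing.scale/=.
have -> : x `^ (a + 1) = x `^ a * x.
  by rewrite powRD ?powRr1 ?(ltW x0)// (gt_eqF x0) implybT.
by ring.
Qed.

Lemma continuous_chi_kernel (a x : R) : 0 < x ->
  {for x, continuous (fun x : R => x `^ a * expR (- x ^+ 2 / 2))}.
Proof.
move=> x0; apply: cvgM; first exact: continuous_powR_gt0.
apply: (@cvg_comp _ _ _ (fun x : R => - x ^+ 2 / 2) expR); last exact: continuous_expR.
apply: cvgM; last exact: cvg_cst.
apply: cvgN; exact: exprn_continuous.
Qed.

Let A (n : nat) : set R := `[n.+1%:R^-1, n.+2%:R].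
Let g (a x : R) := x `^ a * expR (- x ^+ 2 / 2).

Let A_gt0 n x : A n x -> 0 < x.
Proof. by rewrite /A/= in_itv/= => /andP[h _]; rewrite (lt_le_trans _ h). Qed.

Let mgA a n : measurable_fun (A n) (fun x => (g a x)%:E).
Proof.
apply/measurable_EFinP; apply: subspace_continuous_measurable_fun; first exact: measurable_itv.
by apply: continuous_in_subspaceT => x /set_mem/A_gt0; exact: continuous_chi_kernel.
Qed.

Let g0 a x : 0 <= g a x. Proof. by rewrite mulr_ge0 ?powR_ge0 ?expR_ge0. Qed.

(** For integration by parts it is easier to work on compact intervals exhausting
    ]0, +oo[, away from the possible singularity at 0. *)
Lemma cvg_integral_chi_kernel (a : R) :
  (\int[mu]_(x in A n) (g (a - 1) x)%:E)%E @[n --> \oo] -->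
  (\int[mu]_x (chi_kernel a x)%:E)%E.
Proof.
have UA : `]0, +oo[%classic = \bigcup_n A n.
  apply/seteqP; split => [x|x [n _ /A_gt0]] /=; rewrite in_itv/= andbT// => x0.
  have : \forall n \near \oo, n.+1%:R^-1 < x.
    exact: (cvgr_lt _ (@cvg_harmonic R)).
  case=> n1 _ /(_ n1 (leqnn n1)) h1.
  pose n2 := Num.bound x.
  exists (maxn n1 n2) => //; rewrite /A/= in_itv/=; apply/andP; split.
    by rewrite (le_trans _ (ltW h1))// lef_pV2 ?posrE ?ltr0n// ler_nat ltnS leq_maxl.
  have xn2 : x < n2%:R by exact: archi_boundP (ltW x0).
  by rewrite (le_trans (ltW xn2))// ler_nat (leq_trans (leq_maxr n1 n2))// -addn2 leq_addr.
have -> : (\int[mu]_x (chi_kernel a x)%:E = \int[mu]_(x in \bigcup_n A n) (g (a - 1) x)%:E)%E.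
  rewrite -UA [RHS]integral_mkcond; apply: eq_integral => x _.
  rewrite /chi_kernel patchE indicE; case: (x \in _) => /=.
    by rewrite mulr1n mul1r.
  by rewrite mulr0n mul0r.
apply: ge0_nondecreasing_set_cvg_integral => //.
- move=> m n mn; apply/subsetPset => x; rewrite /A/= !in_itv/= => /andP[h1 h2].
  apply/andP; split.
    by rewrite (le_trans _ h1)// lef_pV2 ?posrE ?ltr0n// ler_nat.
  by rewrite (le_trans h2)// ler_nat.
- by move=> n; exact: measurable_itv.
- by move=> n; exact: mgA.
- by move=> n x _; rewrite lee_fin.
Qed.

(** The derivative of x^a expR (- x^2 / 2) is the difference of the two kernels
    up to the factor a, and this function vanishes at 0 and at infinity. The
    identity holds for extended reals: finiteness of the integrals is not
    known at this point. *)
Lemma chi_kernel_rec (a : R) : 0 < a ->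
  (\int[mu]_x (chi_kernel (a + 2) x)%:E =
   a%:E * \int[mu]_x (chi_kernel a x)%:E)%E.
Proof.
move=> a0.
have c1 := cvg_integral_chi_kernel (a + 2).
have c0 := cvg_integral_chi_kernel a.
rewrite (_ : a + 2 - 1 = a + 1) in c1; last by ring.
pose F x := g a x.
have lt_A n : n.+1%:R^-1 < n.+2%:R :> R.
  by rewrite (@le_lt_trans _ _ 1)// ?ltr1n// invf_le1// ler1n.
have intg b n : mu.-integrable (A n) (fun x => (g b x)%:E).
  apply: continuous_compact_integrable; first exact: segment_compact.
  by apply: continuous_in_subspaceT => x /set_mem/A_gt0; exact: continuous_chi_kernel.
have FTC n : (\int[mu]_(x in A n) (g (a + 1) x)%:E =
    a%:E * \int[mu]_(x in A n) (g (a - 1) x)%:E - (F n.+2%:R - F n.+1%:R^-1)%:E)%E.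
  have : (\int[mu]_(x in A n) (a * g (a - 1) x - g (a + 1) x)%:E =
      (F n.+2%:R)%:E - (F n.+1%:R^-1)%:E)%E.
    have dF (x : R) : 0 < x -> is_derive x 1 F (a * g (a - 1) x - g (a + 1) x).
      exact: is_derive_chi_primitive.
    apply: continuous_FTC2 => //.
    - apply: continuous_in_subspaceT => x /set_mem/A_gt0 x0.
      apply: cvgB; last exact: continuous_chi_kernel.
      by apply: cvgM; [exact: cvg_cst|exact: continuous_chi_kernel].
    - have : {within A n, continuous F}.
        apply: derivable_within_continuous => x xA; have /dF : 0 < x by exact: (@A_gt0 n).
        by move=> ?; exact: ex_derive.
      move/(continuous_within_itvP _ (lt_A n)) => [_ ? ?]; split=> // x xI.
      have x0 : 0 < x by move: xI; rewrite in_itv/= => /andP[h _]; rewrite (lt_trans _ h).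
      by have ? := dF _ x0; exact: ex_derive.
    - move=> x xI; have x0 : 0 < x.
        by move: xI; rewrite in_itv/= => /andP[h _]; rewrite (lt_trans _ h).
      by have ? := dF _ x0; rewrite derive1E; exact: derive_val.
  under eq_integral do rewrite EFinB EFinM.
  rewrite integralB//; last 2 first.
  - exact: measurable_itv.
  - apply: integrableZl => //; exact: measurable_itv.
  rewrite integralZl//; last exact: measurable_itv.
  have mA : @measurable _ T (A n) by exact: measurable_itv.
  have := integrable_fin_num mA (intg (a - 1) n).
  have := integrable_fin_num mA (intg (a + 1) n).
  case: (integral _ _ _) => // r _; case: (integral _ _ _) => // s _.
  rewrite -!EFinM -!EFinB => -[h]; congr EFin; lra.
have Fn : F n.+2%:R @[n --> \oo] --> (0 : R).
  pose q := (Num.bound a).+1; pose C : R := 2 ^+ q * q`!%:R.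
  have aq : a <= (q.*2.-1)%:R.
    rewrite (le_trans (ltW (archi_boundP (ltW a0))))// ler_nat /q doubleS /=.
    by rewrite -addnn -addnS leq_addr.
  have F_le (e : R) : 1 <= e -> F e <= C / e.
    move=> e1; have e0 : 0 < e by lra.
    pose y := e ^+ 2 / 2; have y0 : 0 <= y by rewrite divr_ge0// sqr_ge0.
    rewrite ler_pdivlMr//.
    have : e `^ a <= e ^+ q.*2.-1 by rewrite -powR_mulrn ?(ltW e0)// ler_powR.
    have ye : expR (- e ^+ 2 / 2) * expR y = 1.
      by rewrite -expRD /y mulNr addNr expR0.
    have := expR_ge0 (- e ^+ 2 / 2); rewrite /F /g.
    move: (expR _) ye => z ye z0 h.
    rewrite (le_trans (ler_wpM2r (ltW e0) (ler_wpM2r z0 h)))//.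
    have -> : e ^+ q.*2.-1 * z * e = 2 ^+ q * (y ^+ q * z).
      rewrite mulrAC -exprSr /q doubleS/= -[in LHS]doubleS -/q mulrA; congr (_ * z).
      by rewrite -exprMn -muln2 mulnC exprM; congr (_ ^+ q); rewrite /y; field.
    rewrite ler_wpM2l ?exprn_ge0// (le_trans (ler_wpM2r z0 (pow_le_expR q y y0)))//.
    by rewrite -mulrA (mulrC _ z) ye mulr1.
  apply: (@squeeze_cvgr _ _ _ _ (cst 0) (fun n => C * n.+2%:R^-1)).
  - near=> n; rewrite /cst/= g0/= F_le// ler1n//.
  - exact: cvg_cst.
  - rewrite -[X in _ --> X](mulr0 C); apply: cvgM; first exact: cvg_cst.
    by have := @cvg_harmonic R; rewrite -(cvg_shiftn 1); under eq_fun do rewrite addn1.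
have F0 : F n.+1%:R^-1 @[n --> \oo] --> (0 : R).
  have p0 : n.+1%:R^-1 `^ a @[n --> \oo] --> (0 : R).
    apply: (cvg_at_rightP _ _ _).1 (powR_cvg0 a0) (fun n => n.+1%:R^-1) _.
    by split=> [n|]; [rewrite invr_gt0|exact: cvg_harmonic].
  apply: (@squeeze_cvgr _ _ _ _ (cst 0) (fun n => n.+1%:R^-1 `^ a)) => //; last exact: cvg_cst.
  near=> n; rewrite /cst/= g0/= /F /g ler_piMr ?powR_ge0// -[leRHS]expR0 ler_expR.
have c2 : (a%:E * \int[mu]_(x in A n) (g (a - 1) x)%:E - (F n.+2%:R - F n.+1%:R^-1)%:E)%E
   @[n --> \oo] --> (a%:E * \int[mu]_x (chi_kernel a x)%:E - (0 - 0)%:E)%E.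
  apply: cvgeB.
  - by rewrite subr0 fin_num_adde_defl.
  - by apply: cvgeZl.
  - apply: cvg_EFin; first exact: nearW.
    exact: cvgB.
rewrite subr0 sube0 in c2.
have E : (fun n => (\int[mu]_(x in A n) (g (a + 1) x)%:E)%E) =
  (fun n => (a%:E * \int[mu]_(x in A n) (g (a - 1) x)%:E
    - (F n.+2%:R - F n.+1%:R^-1)%:E)%E) by apply/funext => n; exact: FTC.
rewrite E in c1.
exact: (cvg_unique _ c1 c2).
Unshelve. all: by end_near. Qed.

End chi.

Section chi_moments.
Context {R : realType}.
Local Notation mu := (@lebesgue_measure R).

Lemma measurable_chi_kernel (nu : R) : measurable_fun [set: R] (chi_kernel nu).
Proof.
apply: measurable_funM; first exact: measurable_indic.
apply: measurable_funM; first exact: measurable_powR.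
apply: measurableT_comp => //; apply: measurable_funM => //.
by apply: measurableT_comp => //; exact: measurable_funX.
Qed.

Lemma chi_kernel_shift (nu x : R) (p : nat) :
  x ^+ (2 * p) * chi_kernel nu x = chi_kernel (nu + 2 * p%:R) x.
Proof.
rewrite /chi_kernel !indicE; have [|_] := boolP (x \in _); last by rewrite /= !mulr0n !mul0r mulr0.
rewrite inE/= in_itv/= andbT => x0; rewrite !mulr1n !mul1r mulrA; congr (_ * _).
rewrite -powR_mulrn ?(ltW x0)// -powRD ?(gt_eqF x0) ?implybT//.
by congr (_ `^ _); rewrite natrM; ring.
Qed.

(** The p-th moment of a chi-square variable with nu degrees of freedom. *)
Definition chi2_moment (nu : R) (p : nat) : R := \prod_(i < p) (nu + 2 * i%:R).

Lemma integral_chi_kernel_shift (nu : R) (p : nat) : 0 < nu ->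
  (\int[mu]_x (chi_kernel (nu + 2 * p%:R) x)%:E =
   (chi2_moment nu p)%:E * \int[mu]_x (chi_kernel nu x)%:E)%E.
Proof.
move=> nu0; elim: p => [|p IHp].
  by rewrite mulr0 addr0 /chi2_moment big_ord0 mul1e.
rewrite (_ : nu + 2 * p.+1%:R = nu + 2 * p%:R + 2); last by rewrite -natr1; ring.
have nup : 0 < nu + 2 * p%:R by rewrite ltr_wpDr ?mulr_ge0.
rewrite (chi_kernel_rec _ nup) IHp muleA; congr (_ * _)%E.
by rewrite -EFinM /chi2_moment big_ord_recr/= mulrC.
Qed.

(** A normalization by an infinite or zero integral would make the density vanish
    identically, so a total mass of 1 forces the integral to be finite and
    positive. *)
Lemma integral_chi_kernel (nu : R) :
  (chi_distribution nu [set: R] = 1)%E ->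
  exists2 c : R, 0 < c & (\int[mu]_x (chi_kernel nu x)%:E = c%:E)%E /\
    forall x, chi_pdf nu x = chi_kernel nu x / c.
Proof.
rewrite /chi_distribution/= /density_measure => tot.
pose I := (\int[mu]_x (chi_kernel nu x)%:E)%E.
have I0 : (0 <= I)%E by apply: integral_ge0 => x _; rewrite lee_fin chi_kernel_ge0.
have pdfE x : chi_pdf nu x = chi_kernel nu x / fine I by [].
have f0 : fine I != 0.
  apply/eqP => I00; move: tot; rewrite integral0_eq.
    by move=> /eqP; rewrite eqe eq_sym oner_eq0.
  by move=> x _; rewrite pdfE I00 invr0 mulr0.
move: I0 f0 pdfE; rewrite -/I; case: I => [c| |]; rewrite /= ?eqxx// lee_fin => c0 cn0 pdfE.
by exists c; rewrite ?lt_neqAle 1?eq_sym ?cn0.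
Qed.

Lemma chi_moment (nu : R) (p : nat) : 0 < nu ->
  (chi_distribution nu [set: R] = 1)%E ->
  (\int[chi_distribution nu]_x (x ^+ (2 * p))%:E = (chi2_moment nu p)%:E)%E.
Proof.
move=> nu0 /integral_chi_kernel[c c0 [Ic pdfE]].
have mX : measurable_fun [set: R] (fun x : R => (x ^+ (2 * p))%:E).
  by apply/measurable_EFinP; exact: measurable_funX.
have X0 (x : R) : (0 <= (x ^+ (2 * p))%:E)%E.
  by rewrite lee_fin exprM exprn_ge0// sqr_ge0.
have mpdf : measurable_fun [set: R] (@chi_pdf R nu).
  by apply/measurable_EFinP; exact: measurable_chi_pdf.
have pdf0 x : 0 <= chi_pdf nu x by have := chi_pdf_ge0 nu x; rewrite lee_fin.
rewrite (@ge0_integral_density R (chi_distribution nu) (chi_pdf nu) _ mpdf pdf0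
  (fun _ _ => erefl) mX X0).
transitivity (\int[mu]_x (c^-1%:E * (chi_kernel (nu + 2 * p%:R) x)%:E))%E.
  apply: eq_integral => x _; rewrite -!EFinM; congr EFin.
  by rewrite pdfE -chi_kernel_shift; ring.
rewrite ge0_integralZl_EFin ?invr_ge0 ?(ltW c0)//.
- rewrite integral_chi_kernel_shift// Ic -!EFinM; congr EFin.
  by rewrite mulrCA mulVf ?mulr1// gt_eqF.
- by move=> x _; rewrite lee_fin chi_kernel_ge0.
- by apply/measurable_EFinP; exact: measurable_chi_kernel.
Qed.

Lemma chi_le0 (nu : R) : chi_distribution nu `]-oo, 0]%classic = 0%E.
Proof.
rewrite /chi_distribution/= /density_measure integral0_eq// => x /=.
rewrite in_itv/= => x0; rewrite /chi_pdf /chi_kernel indicE memNset ?mul0r//=.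
by rewrite in_itv/= andbT ltNge x0.
Qed.

(** The value of E[Y^j (Y - nu)^p] when Y has the moments e. *)
Fixpoint mixed_moment (e : nat -> R) (nu : R) (p j : nat) : R :=
  if p is p'.+1 then
    mixed_moment e nu p' j.+1 - nu * mixed_moment e nu p' j
  else e j.

(** The chi-square recursion e_(j+1) = (nu + 2j) e_j is the case p = 0; it
    propagates through the definition of the mixed moments. *)
Lemma mixed_moment_rec (nu : R) (p j : nat) :
  mixed_moment (chi2_moment nu) nu p.+1 j =
  2 * j%:R * mixed_moment (chi2_moment nu) nu p j +
  2 * p%:R * mixed_moment (chi2_moment nu) nu p.-1 j.+1.
Proof.
elim: p j => [|p IHp] j.
  have -> : mixed_moment (chi2_moment nu) nu 1 j =
      chi2_moment nu j * (nu + 2 * j%:R) - nu * chi2_moment nu j.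
    by rewrite /= /chi2_moment big_ord_recr.
  rewrite mulr0 mul0r addr0 -[mixed_moment _ _ 0 j]/(chi2_moment nu j).
  by move: (chi2_moment nu j) (j%:R) => x y; ring.
rewrite [LHS]/= -/(mixed_moment _ nu p.+1 j.+1) -/(mixed_moment _ nu p.+1 j).
rewrite ![in LHS]IHp.
case: p IHp => [|p] IHp /=; rewrite -!natr1; ring.
Qed.

Lemma central_moment_rec (nu : R) (p : nat) :
  let m q := mixed_moment (chi2_moment nu) nu q 0 in
  m p.+2 = 2 * p.+1%:R * (m p.+1 + nu * m p).
Proof. by move=> m; rewrite /m mixed_moment_rec mulr0 mul0r add0r /=; ring. Qed.

(** The recursion [central_moment_rec] with nu replaced by 1, that is, after the
    powers of 1 + nu have been factored out. *)
Fixpoint central_const (p : nat) : R :=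
  match p with
  | 0 => 1
  | p1.+1 => match p1 with
             | 0 => 0
             | p2.+1 => 2 * p1%:R * (central_const p1 + central_const p2)
             end
  end.

Lemma central_const_ge0 p : 0 <= central_const p.
Proof.
suff : 0 <= central_const p /\ 0 <= central_const p.+1 by case.
elim: p => [|p [IH1 IH2]]; first by rewrite /= ler01 lexx.
split=> //; rewrite [central_const _]/= -/(central_const p.+1).
by rewrite mulr_ge0 ?addr_ge0// mulr_ge0.
Qed.

(** In [central_moment_rec] the order grows by 2 for each factor nu, which gives
    the exponent p/2 in place of p. This gain is what makes the deviations of
    b_n summable. *)
Lemma central_moment_le (nu : R) (p : nat) : 0 <= nu ->
  `|mixed_moment (chi2_moment nu) nu p 0| <= central_const p * (1 + nu) ^+ p./2.
Proof.
move=> nu0; pose m q := mixed_moment (chi2_moment nu) nu q 0.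
have n1 : 1 <= 1 + nu by rewrite lerDl.
have n0 : 0 <= 1 + nu by lra.
suff : `|m p| <= central_const p * (1 + nu) ^+ p./2 /\
       `|m p.+1| <= central_const p.+1 * (1 + nu) ^+ p.+1./2 by case.
elim: p => [|p [IH1 IH2]].
  have -> : m 0%N = 1 by rewrite /m/= /chi2_moment big_ord0.
  have -> : m 1%N = 0.
    by rewrite /m/= /chi2_moment big_ord_recr big_ord0/= mulr0 addr0 mul1r mulr1 subrr.
  by rewrite /= normr1 normr0 mul0r expr0 mul1r !lexx.
split=> //; rewrite [m _]central_moment_rec -/(m _) -/(m _).
rewrite [central_const _]/= -/(central_const p.+1) normrM ger0_norm ?mulr_ge0// -mulrA.
rewrite ler_wpM2l ?mulr_ge0// mulrDl (le_trans (ler_normD _ _))// lerD//.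
  rewrite (le_trans IH2)// ler_wpM2l ?central_const_ge0//.
  by rewrite ler_weXn2l// half_leq.
rewrite normrM (ger0_norm nu0) /= exprS mulrCA.
by rewrite ler_pM// lerDr.
Qed.

Lemma mixed_momentP d (Omega : measurableType d) (P : probability Omega R)
    (Y : Omega -> R) (e : nat -> R) (nu : R) :
  measurable_fun [set: Omega] Y -> (forall w, 0 <= Y w) ->
  (forall j, \int[P]_w (Y w ^+ j)%:E = (e j)%:E)%E ->
  forall p j, P.-integrable [set: Omega] (fun w => (Y w ^+ j * (Y w - nu) ^+ p)%:E) /\
   (\int[P]_w (Y w ^+ j * (Y w - nu) ^+ p)%:E = (mixed_moment e nu p j)%:E)%E.
Proof.
move=> mY Y0 Ye; elim=> [|p IHp] j.
  have E w : Y w ^+ j * (Y w - nu) ^+ 0 = Y w ^+ j by rewrite expr0 mulr1.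
  under [X in _ /\ X = _]eq_integral do rewrite E.
  split; last exact: Ye.
  apply/integrableP; split.
    by apply/measurable_EFinP; apply: measurable_funM => //; exact: measurable_funX.
  under eq_integral do rewrite E gee0_abs ?lee_fin ?exprn_ge0//.
  by rewrite Ye ltry.
have [i1 e1] := IHp j.+1; have [i0 e0] := IHp j.
have E w : (Y w ^+ j * (Y w - nu) ^+ p.+1)%:E =
   ((Y w ^+ j.+1 * (Y w - nu) ^+ p)%:E - nu%:E * (Y w ^+ j * (Y w - nu) ^+ p)%:E)%E.
  by rewrite -EFinM -EFinB; congr EFin; rewrite !exprS; ring.
have i2 : P.-integrable [set: Omega] (fun w => (nu%:E * (Y w ^+ j * (Y w - nu) ^+ p)%:E)%E).
  exact: integrableZl.
split.
  by apply: eq_integrable (integrableB measurableT i1 i2) => // w _; rewrite E.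
under eq_integral do rewrite E.
by rewrite integralB// integralZl// e1 e0 -EFinM -EFinB.
Qed.

End chi_moments.

(** * Deviations in the beta-ensemble model *)

Section beta_deviations.
Context {R : realType}.
Context {d : measure_display} {Omega : measurableType d} {P : probability Omega R}.
Variables (beta : R) (beta_gt0 : 0 < beta) (dv bv : nat -> {RV P >-> R}).
Hypothesis beta_dv : forall n, (1 <= n)%N ->
  has_law P (fun w => Num.sqrt beta * dv n w) (normal_prob 0 (Num.sqrt 2)).
Hypothesis beta_bv : forall n, (1 <= n)%N ->
  has_law P (fun w => Num.sqrt beta * bv n w) (chi_distribution (n%:R * beta)).

(** The law of sqrt beta d_n does not depend on n, which leaves the factor n^-q. *)
Lemma diagonal_moment (q : nat) : exists2 C : R, 0 <= C &
  forall n, (1 <= n)%N ->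
    (\int[P]_w (((dv n w) ^+ 2 / n%:R) ^+ q)%:E <= (C / n%:R ^+ q)%:E)%E.
Proof.
have := normal_even_moment_lty q (R := R).
have : (0 <= \int[normal_prob 0 (Num.sqrt 2)]_x (x ^+ (2 * q))%:E :> \bar R)%E.
  by apply: integral_ge0 => x _; rewrite lee_fin exprM exprn_ge0// sqr_ge0.
case E : (integral _ _ _) => [K| |]//; rewrite lee_fin => K0 _.
exists (K / beta ^+ q); first by rewrite divr_ge0// exprn_ge0// ltW.
move=> n n1; have n0 : n%:R != 0 :> R by rewrite pnatr_eq0; lia.
have mX : measurable_fun [set: R] (fun x : R => (x ^+ (2 * q))%:E).
  by apply/measurable_EFinP; exact: measurable_funX.
have X0 (x : R) : (0 <= (x ^+ (2 * q))%:E)%E.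
  by rewrite lee_fin exprM exprn_ge0// sqr_ge0.
have mdv : measurable_fun [set: Omega] (fun w => Num.sqrt beta * dv n w).
  exact: measurable_funM.
have := has_law_integral _ _ _ _ _ _ mdv (beta_dv n n1) mX X0.
rewrite E => EK.
have c0 : 0 <= (beta * n%:R) ^- q by rewrite invr_ge0 exprn_ge0// mulr_ge0// ltW.
under eq_integral => w _.
  rewrite (_ : (dv n w ^+ 2 / n%:R) ^+ q =
     (beta * n%:R) ^- q * (Num.sqrt beta * dv n w) ^+ (2 * q)); last first.
    rewrite [in RHS](exprM _ 2) [in RHS](exprMn 2) sqr_sqrtr ?(ltW beta_gt0)//.
    rewrite !(exprMn q) exprVn.
    have bq : beta ^+ q != 0 by rewrite expf_neq0// gt_eqF.
    have nq : (n%:R : R) ^+ q != 0 by rewrite expf_neq0.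
    by move: ((dv n w ^+ 2) ^+ q) (beta ^+ q) (n%:R ^+ q : R) bq nq => x y z y0 z0; field; rewrite y0 z0.
  rewrite EFinM.
  over.
rewrite ge0_integralZl_EFin//; last first.
  by apply/measurable_EFinP; exact: measurable_funX.
rewrite EK -EFinM lee_fin exprMn invfM.
by rewrite [leLHS]mulrC mulrA.
Qed.

(** The variable beta b_n^2 is chi-square with nu = n beta degrees of freedom, so
    that the quantity raised to the power 2q is (beta b_n^2 - nu) / nu. Its
    moment is O(nu^q) / nu^(2q). *)
Lemma offdiagonal_moment (q : nat) : exists2 C : R, 0 <= C &
  forall n, (1 <= n)%N ->
    (\int[P]_w (((bv n w) ^+ 2 / n%:R - 1) ^+ (2 * q))%:E <= (C / n%:R ^+ q)%:E)%E.
Proof.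
pose K : R := central_const (2 * q).
have K0 : 0 <= K := central_const_ge0 _.
exists (K * (1 + beta) ^+ q / beta ^+ (2 * q)).
  by rewrite divr_ge0 ?mulr_ge0 ?exprn_ge0 ?addr_ge0// ltW.
move=> n n1; have n0 : 0 < n%:R :> R by rewrite ltr0n.
have n1' : 1 <= n%:R :> R by rewrite ler1n.
pose nu := n%:R * beta; have nu0 : 0 < nu by rewrite mulr_gt0.
pose Y w := (Num.sqrt beta * bv n w) ^+ 2.
have mX : measurable_fun [set: Omega] (fun w => Num.sqrt beta * bv n w).
  exact: measurable_funM.
have mY : measurable_fun [set: Omega] Y by exact: measurable_funX.
have Y0 w : 0 <= Y w by exact: sqr_ge0.
have tot : (chi_distribution nu [set: R] = 1)%E.
  by rewrite -(beta_bv n n1)// preimage_setT probability_setT.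
have Ye j : (\int[P]_w (Y w ^+ j)%:E = (chi2_moment nu j)%:E)%E.
  rewrite -(chi_moment nu j nu0 tot).
  have mXj : measurable_fun [set: R] (fun x : R => (x ^+ (2 * j))%:E).
    by apply/measurable_EFinP; exact: measurable_funX.
  have X0 (x : R) : (0 <= (x ^+ (2 * j))%:E)%E.
    by rewrite lee_fin exprM exprn_ge0// sqr_ge0.
  rewrite -(has_law_integral _ _ _ _ _ _ mX (beta_bv n n1) mXj X0).
  by apply: eq_integral => w _; rewrite /Y exprM.
have [intY momY] := mixed_momentP _ _ P Y _ nu mY Y0 Ye (2 * q) 0.
have c0 : 0 <= nu ^- (2 * q) by rewrite invr_ge0 exprn_ge0// ltW.
under eq_integral => w _.
  rewrite (_ : (bv n w ^+ 2 / n%:R - 1) ^+ (2 * q) =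
     nu ^- (2 * q) * (Y w ^+ 0 * (Y w - nu) ^+ (2 * q))); last first.
    rewrite expr0 mul1r -exprVn -exprMn; congr (_ ^+ _).
    rewrite /Y exprMn sqr_sqrtr ?(ltW beta_gt0)// /nu; field.
    by rewrite !gt_eqF.
  rewrite EFinM.
  over.
rewrite integralZl//.
rewrite momY -EFinM lee_fin.
have h := central_moment_le nu (2 * q) (ltW nu0).
rewrite mul2n doubleK -mul2n in h.
rewrite (le_trans (ler_wpM2l c0 (le_trans (ler_norm _) h)))//.
have h2 : (1 + nu) ^+ q <= (1 + beta) ^+ q * n%:R ^+ q.
  rewrite -exprMn lerXn2r ?nnegrE ?addr_ge0 ?mulr_ge0 ?addr_ge0 ?(ltW nu0) ?(ltW beta_gt0)//.
  by rewrite mulrDl mul1r (mulrC beta) lerD2r.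
rewrite (le_trans (ler_wpM2l c0 (ler_wpM2l K0 h2)))//.
rewrite /nu !(mulnC 2) !exprM exprMn.
have bq : beta ^+ q != 0 by rewrite expf_neq0// gt_eqF.
have nq : (n%:R : R) ^+ q != 0 by rewrite expf_neq0// gt_eqF.
rewrite le_eqVlt; apply/orP; left; apply/eqP; rewrite -/K.
move: (beta ^+ q) (n%:R ^+ q : R) ((1 + beta) ^+ q) bq nq => x y z x0 y0; field.
by rewrite x0 y0.
Qed.

Definition deviation (q n : nat) (w : Omega) : R :=
  ((dv n w) ^+ 2 / n%:R) ^+ q + ((bv n w) ^+ 2 / n%:R - 1) ^+ (2 * q).

Lemma deviation_ge0 q n w : 0 <= deviation q n w.
Proof.
rewrite addr_ge0//; first by rewrite exprn_ge0// divr_ge0// sqr_ge0.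
by rewrite exprM exprn_ge0// sqr_ge0.
Qed.

Lemma measurable_deviation q n : measurable_fun [set: Omega] (deviation q n).
Proof.
apply: measurable_funD; apply: measurable_funX; last apply: measurable_funB => //;
by apply: measurable_funM => //; apply: measurable_funX.
Qed.

Lemma sum_inv_square n : \sum_(i < n) (i.+1%:R ^+ 2)^-1 <= 2 :> R.
Proof.
suff : \sum_(i < n) (i.+1%:R ^+ 2)^-1 <= 2 - 2 / n.+1%:R :> R.
  by move=> /le_trans; apply; rewrite gerBl divr_ge0.
elim: n => [|n IHn]; first by rewrite big_ord0 divr1 subrr.
rewrite big_ord_recr/= (le_trans (lerD IHn (lexx _)))//.
have x0 : 1 <= n.+1%:R :> R by rewrite ler1n.
rewrite -[n.+2%:R]natr1; move: (n.+1%:R : R) x0 => x x1.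
have x0 : 0 < x by lra.
rewrite -subr_ge0.
rewrite (_ : _ - _ = (x - 1) / (x ^+ 2 * (x + 1))); last first.
  by field; rewrite !gt_eqF//; lra.
by rewrite divr_ge0 ?mulr_ge0 ?sqr_ge0//; lra.
Qed.

Definition total_deviation q w : \bar R :=
  (\sum_(n <oo) (deviation q n.+1 w)%:E)%E.

Lemma measurable_total_deviation q : measurable_fun [set: Omega] (total_deviation q).
Proof.
apply: (@ge0_emeasurable_sum _ _ _ _ _ xpredT) => [n w _ _|n _].
  by rewrite lee_fin deviation_ge0.
by apply/measurable_EFinP; exact: measurable_deviation.
Qed.

Lemma total_deviation_ge0 q w : (0 <= total_deviation q w)%E.
Proof. by apply: nneseries_ge0 => n _ _; rewrite lee_fin deviation_ge0. Qed.

Lemma integral_total_deviation q : (2 <= q)%N ->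
  (\int[P]_w total_deviation q w < +oo)%E.
Proof.
move=> q2; have [C1 C10 H1] := diagonal_moment q.
have [C2 C20 H2] := offdiagonal_moment q.
rewrite /total_deviation integral_nneseries//; last 2 first.
- by move=> n; apply/measurable_EFinP; exact: measurable_deviation.
- by move=> n w _; rewrite lee_fin deviation_ge0.
have H n : (\int[P]_w (deviation q n.+1 w)%:E <= ((C1 + C2) * (n.+1%:R ^+ 2)^-1)%:E)%E.
  under eq_integral do rewrite EFinD.
  rewrite ge0_integralD//; last 4 first.
  - by move=> w _; rewrite lee_fin exprn_ge0// divr_ge0// sqr_ge0.
  - apply/measurable_EFinP; apply: measurable_funX; apply: measurable_funM => //.
    exact: measurable_funX.
  - by move=> w _; rewrite lee_fin exprM exprn_ge0// sqr_ge0.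
  - apply/measurable_EFinP; apply: measurable_funX; apply: measurable_funB => //.
    by apply: measurable_funM => //; exact: measurable_funX.
  rewrite (le_trans (leeD (H1 n.+1 isT) (H2 n.+1 isT)))// -EFinD lee_fin -mulrDl.
  rewrite ler_wpM2l ?addr_ge0// lef_pV2 ?posrE ?exprn_gt0 ?ltr0n//.
  by rewrite ler_weXn2l// ler1n.
apply: (@le_lt_trans _ _ ((C1 + C2) * 2)%:E); last exact: ltry.
apply: lime_le.
  by apply: is_cvg_nneseries => n _ _; apply: integral_ge0 => w _; rewrite lee_fin deviation_ge0.
apply: nearW => n; apply: (le_trans (lee_sum _ (fun i _ => H i))).
rewrite big_mkord sumEFin lee_fin -mulr_sumr ler_wpM2l ?addr_ge0//.
exact: sum_inv_square.
Qed.

End beta_deviations.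

(** * From deviations to traces *)

Lemma cvg0_of_cvg0_pow {R : realType} (u : nat -> R) m : (0 < m)%N ->
  u n ^+ m @[n --> \oo] --> (0 : R) -> u n @[n --> \oo] --> (0 : R).
Proof.
move=> m0 um; apply/cvgr0Pnorm_lt => e e0.
have H := cvgr0_norm_lt _ um (e ^+ m) (exprn_gt0 m e0).
near=> n; have : `|u n ^+ m| < e ^+ m by near: n; exact: H.
by rewrite normrX ltr_pXn2r// ?nnegrE// ltW.
Unshelve. all: by end_near. Qed.

Lemma expr_le_of_small {R : realType} (y K : R) (j l : nat) : 0 <= y -> 1 <= K ->
  (j <= l)%N -> y ^+ l <= K -> y ^+ j <= K.
Proof.
move=> y0 K1 jl yK; have [y1|y1] := leP y 1.
  by rewrite (le_trans _ K1)// exprn_ile1.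
by rewrite (le_trans _ yK)// ler_weXn2l// ltW.
Qed.

(** Up to x = 2 the constant term suffices; beyond, x <= 2 (x - 1). *)
Lemma expr_le_deviation {R : realType} (x : R) q : 0 <= x ->
  x ^+ (2 * q) <= 4 ^+ q * (1 + (x - 1) ^+ (2 * q)).
Proof.
move=> x0; have h0 : 0 <= (x - 1) ^+ (2 * q) by rewrite exprM exprn_ge0// sqr_ge0.
have e4 : 4 ^+ q = 2 ^+ (2 * q) :> R by rewrite exprM expr2; congr (_ ^+ _); lra.
have f0 : 0 <= 4 ^+ q :> R by rewrite exprn_ge0.
rewrite mulrDr mulr1; have [x2|x2] := leP x 2.
  rewrite (le_trans (_ : _ <= 4 ^+ q)) ?lerDl ?mulr_ge0// e4.
  by rewrite lerXn2r ?nnegrE.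
rewrite (le_trans (_ : _ <= 4 ^+ q * (x - 1) ^+ (2 * q))) ?lerDr// e4 -exprMn.
by rewrite lerXn2r ?nnegrE//; lra.
Qed.

Section trajectory.
Context {R : realType}.
Implicit Types dv bv : nat -> R.

Let sqr_div_sqrt (x : R) n : (x / Num.sqrt n%:R) ^+ 2 = x ^+ 2 / n%:R.
Proof. by rewrite expr_div_n sqr_sqrtr// ler0n. Qed.

(** Each |d_p| / sqrt p and |b_p| / sqrt p is controlled by a root of the
    deviation at p, whence a bound D on all the entries of the scaled matrix
    with D^(k+1) affine in r, and D^k <= D^(k+1) since D >= 1. *)
Lemma normalized_trace_bound dv bv (q k n : nat) (r : R) : (k < q)%N -> 0 <= r ->
  (forall p, (0 < p)%N ->
    (dv p ^+ 2 / p%:R) ^+ q + (bv p ^+ 2 / p%:R - 1) ^+ (2 * q) <= r) ->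
  `|normalized_trace (scaled_beta_matrix dv bv n ^+ k)| <=
    3 ^+ k * (1 + 4 ^+ q * (1 + r)).
Proof.
move=> kq r0 H; pose K := 1 + 4 ^+ q * (1 + r).
have f1 : 1 <= 4 ^+ q :> R by rewrite exprn_ege1// ler1n.
have K1 : 1 <= K by rewrite lerDl mulr_ge0 ?exprn_ge0 ?addr_ge0.
have rK : r <= K.
  have : 1 + r <= 4 ^+ q * (1 + r) by rewrite ler_peMl// addr_ge0.
  rewrite /K; lra.
pose D := K `^ (k.+1%:R)^-1.
have DK : D ^+ k.+1 = K.
  rewrite -powR_mulrn ?powR_ge0// -powRrM mulVf// powRr1// (le_trans ler01)//.
have D0 : 0 <= D by exact: powR_ge0.
have D1 : 1 <= D.
  by rewrite -(@ler_pXn2r _ k.+1)// ?nnegrE// expr1n DK.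
have bound (y : R) : 0 <= y -> y ^+ k.+1 <= K -> y <= D.
  by move=> y0; rewrite -DK ler_pXn2r// nnegrE.
have a0 p : 0 <= (dv p ^+ 2 / p%:R) ^+ q by rewrite exprn_ge0// divr_ge0// sqr_ge0.
have b0 p : 0 <= (bv p ^+ 2 / p%:R - 1) ^+ (2 * q).
  by rewrite exprM exprn_ge0// sqr_ge0.
have sq (x : R) p : (`|x| / Num.sqrt p%:R) ^+ 2 = x ^+ 2 / p%:R.
  by rewrite sqr_div_sqrt real_normK// num_real.
have dD p : (0 < p)%N -> `|dv p| / Num.sqrt p%:R <= D.
  move=> p0; have y0 : 0 <= `|dv p| / Num.sqrt p%:R by rewrite divr_ge0// sqrtr_ge0.
  apply: bound => //; apply: (@expr_le_of_small _ _ _ _ (2 * q)) => //; first by lia.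
  rewrite exprM sq (le_trans _ rK)// (le_trans _ (H p p0))// lerDl//.
have bD p : (0 < p)%N -> `|bv p| / Num.sqrt p%:R <= D.
  move=> p0; have y0 : 0 <= `|bv p| / Num.sqrt p%:R by rewrite divr_ge0// sqrtr_ge0.
  apply: bound => //; apply: (@expr_le_of_small _ _ _ _ (2 * (2 * q))) => //; first by lia.
  rewrite exprM sq (le_trans (expr_le_deviation _ q _)) ?divr_ge0 ?sqr_ge0//.
  rewrite /K (le_trans _ (_ : 4 ^+ q * (1 + r) <= _)) ?lerDr//.
  rewrite ler_wpM2l ?exprn_ge0// lerD2l (le_trans _ (H p p0))// lerDr//.
have XD := scaled_entry_le dv bv D n dD bD.
have [->|n0] := posnP n.
  rewrite /normalized_trace invr0 mul0r normr0 mulr_ge0 ?exprn_ge0//.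
  by rewrite (le_trans ler01).
rewrite /normalized_trace normrM normfV normr_nat /mxtrace ler_pdivrMl ?ltr0n//.
rewrite (le_trans (ler_norm_sum _ _ _))//.
rewrite (le_trans (ler_sum _ (fun i _ => scaled_beta_matrix_pow_le dv bv n k D i i XD)))//.
rewrite sumr_const card_ord -[leLHS](mulr_natl _ n) ler_wpM2l// exprMn ler_wpM2l ?exprn_ge0//.
by rewrite -/K -DK ler_weXn2l.
Qed.

Lemma cvg_of_deviation dv bv (q : nat) : (0 < q)%N ->
  (forall n, 0 < bv n.+1) ->
  (dv n ^+ 2 / n%:R) ^+ q + (bv n ^+ 2 / n%:R - 1) ^+ (2 * q) @[n --> \oo] --> (0 : R) ->
  dv n / Num.sqrt n%:R @[n --> \oo] --> (0 : R) /\
  bv n / Num.sqrt n%:R @[n --> \oo] --> (1 : R).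
Proof.
move=> q0 bpos H.
have a0 n : 0 <= (dv n ^+ 2 / n%:R) ^+ q by rewrite exprn_ge0// divr_ge0// sqr_ge0.
have b0 n : 0 <= (bv n ^+ 2 / n%:R - 1) ^+ (2 * q).
  by rewrite exprM exprn_ge0// sqr_ge0.
split.
  apply: (@cvg0_of_cvg0_pow _ _ (2 * q)); first by lia.
  apply: squeeze_cvgr (@cvg_cst _ (0 : R) _ _ _) H; apply: nearW => n.
  by rewrite exprM sqr_div_sqrt a0/= lerDl.
have c0 : bv n ^+ 2 / n%:R - 1 @[n --> \oo] --> (0 : R).
  apply: (@cvg0_of_cvg0_pow _ _ (2 * q)); first by lia.
  apply: squeeze_cvgr (@cvg_cst _ (0 : R) _ _ _) H; apply: nearW => n.
  by rewrite b0/= lerDr.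
have c1 : bv n ^+ 2 / n%:R @[n --> \oo] --> (1 : R).
  rewrite -[X in _ --> X]add0r; under eq_fun do rewrite -(subrK 1 (_ / _)).
  by apply: cvgD => //; exact: cvg_cst.
have c2 : Num.sqrt (bv n ^+ 2 / n%:R) @[n --> \oo] --> (1 : R).
  by rewrite -[X in _ --> X]sqrtr1; apply: continuous_cvg c1; exact: sqrt_continuous.
apply: cvg_trans c2; apply: near_eq_cvg; near=> n.
have n0 : (0 < n)%N by near: n; exact: nbhs_infty_gt.
have bn : 0 <= bv n by rewrite -(prednK n0) ltW.
by rewrite sqrtrM ?sqr_ge0// sqrtr_sqr ger0_norm// sqrtrV ?ler0n.
Unshelve. all: by end_near. Qed.

End trajectory.

Section beta_trace.
Context {R : realType}.
Context {d : measure_display} {Omega : measurableType d} {P : probability Omega R}.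
Variables (beta : R) (beta_gt0 : 0 < beta) (dv bv : nat -> {RV P >-> R}).
Hypothesis beta_dv : forall n, (1 <= n)%N ->
  has_law P (fun w => Num.sqrt beta * dv n w) (normal_prob 0 (Num.sqrt 2)).
Hypothesis beta_bv : forall n, (1 <= n)%N ->
  has_law P (fun w => Num.sqrt beta * bv n w) (chi_distribution (n%:R * beta)).

Let S := total_deviation dv bv.
Let X n w := scaled_beta_matrix (fun i => dv i w) (fun i => bv i w) n.

Lemma integrable_total_deviation q : (2 <= q)%N -> P.-integrable [set: Omega] (S q).
Proof.
move=> q2; apply/integrableP; split; first exact: measurable_total_deviation.
under eq_integral do rewrite gee0_abs ?total_deviation_ge0//.
exact: integral_total_deviation beta_gt0 _ _ beta_dv beta_bv _ q2.
Qed.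

Lemma sum_deviation_le q n w :
  ((\sum_(0 <= i < n) deviation dv bv q i.+1 w)%:E <= S q w)%E.
Proof.
rewrite -sumEFin; apply: nneseries_lim_ge => i _ _.
by rewrite lee_fin deviation_ge0.
Qed.

Lemma deviation_le_total q p w : (0 < p)%N ->
  ((deviation dv bv q p w)%:E <= S q w)%E.
Proof.
move=> p0; apply: le_trans (sum_deviation_le q p w); rewrite lee_fin.
rewrite -{1 2}(prednK p0) big_nat_recr//= lerDr sumr_ge0// => i _.
exact: deviation_ge0.
Qed.

Lemma ae_total_deviation_fin q : (2 <= q)%N ->
  {ae P, forall w, S q w \is a fin_num}.
Proof.
move=> q2; have := integrable_ae measurableT (integrable_total_deviation q q2).
by apply: filterS => w; apply.
Qed.

Lemma cvg_deviation q w : S q w \is a fin_num ->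
  deviation dv bv q n w @[n --> \oo] --> (0 : R).
Proof.
move=> Sfin; rewrite -(cvg_shiftn 1); under eq_fun do rewrite addn1.
apply: cvg_series_cvg_0; apply: nondecreasing_is_cvgn.
  by apply: nondecreasing_series => n _ _; exact: deviation_ge0.
exists (fine (S q w)) => _ [n _ <-].
by rewrite -lee_fin fineK//; exact: sum_deviation_le.
Qed.

(** The deviations control b_n^2 only; positivity gives b_n itself. *)
Lemma ae_offdiagonal_gt0 : {ae P, forall w, forall n, 0 < bv n.+1 w}.
Proof.
apply: ae_foralln => n.
exists ((fun w => Num.sqrt beta * bv n.+1 w) @^-1` `]-oo, 0]%classic); split.
- rewrite -[X in measurable X]setTI.
  have mf : measurable_fun [set: Omega] (fun w => Num.sqrt beta * bv n.+1 w).
    exact: measurable_funM.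
  by apply: mf => //; exact: measurable_itv.
- apply: etrans (beta_bv n.+1 isT _ (measurable_itv _)) _.
  exact: chi_le0.
- move=> w /= /negP; rewrite -leNgt in_itv/= => bw.
  by rewrite mulr_ge0_le0// sqrtr_ge0.
Qed.

Lemma ae_cvg_normalized_trace k :
  {ae P, forall w, normalized_trace (X n w ^+ k) @[n --> \oo] -->
    ((1 / 2 * k%:R + 1)^-1 * (walks k 0)%:R : R)}.
Proof.
have := ae_total_deviation_fin 2 isT; have := ae_offdiagonal_gt0.
apply: filterS2 => w bpos Sfin.
have [c1 c2] := cvg_of_deviation (fun n => dv n w) (fun n => bv n w) 2 isT bpos
  (cvg_deviation _ _ Sfin).
exact: cvg_normalized_trace c1 c2.
Qed.

Lemma measurable_entry_pow n k (i j : 'I_n) :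
  measurable_fun [set: Omega] (fun w => (X n w ^+ k) i j).
Proof.
elim: k i j => [|k IHk] i j.
  by under eq_fun do rewrite expr0; exact: measurable_cst.
under eq_fun do rewrite exprS mxE.
apply: measurable_sum => l; apply: measurable_funM; last exact: IHk.
rewrite /X /scaled_beta_matrix /beta_matrix.
under eq_fun do rewrite !mxE.
apply: measurable_funM => //.
by case: (i == l) => //; case: (l == i.+1 :> nat) => //; case: (i == l.+1 :> nat).
Qed.

Lemma measurable_normalized_trace n k :
  measurable_fun [set: Omega] (fun w => normalized_trace (X n w ^+ k)).
Proof.
apply: measurable_funM => //; apply: measurable_sum => i.
exact: measurable_entry_pow.
Qed.

(** The integrable function which dominates the k-th traces of all sizes. *)
Definition trace_bound k w : \bar R :=
  ((3 ^+ k)%:E * (1%:E + (4 ^+ k.+2)%:E * (1%:E + S k.+2 w)))%E.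

Lemma normalized_trace_le k n w :
  (`|(normalized_trace (X n w ^+ k))%:E| <= trace_bound k w)%E.
Proof.
rewrite /trace_bound; have := total_deviation_ge0 dv bv k.+2 w.
have := fun p => deviation_le_total k.+2 p w.
rewrite -/S; case: (S k.+2 w) => [r| |]// H r0.
  rewrite -!EFinD -EFinM abse_EFin lee_fin.
  by rewrite lee_fin in r0; apply: normalized_trace_bound.
by rewrite addey// gt0_muley ?lte_fin ?exprn_gt0// addey// gt0_muley ?lte_fin ?exprn_gt0// leey.
Qed.

Lemma integrable_trace_bound k : P.-integrable [set: Omega] (trace_bound k).
Proof.
have i1 : P.-integrable [set: Omega] (cst (1%:E : \bar R)).
  exact: finite_measure_integrable_cst.
apply: integrableZl => //; apply: integrableD => //.
apply: integrableZl => //; apply: integrableD => //.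
exact: integrable_total_deviation.
Qed.

Lemma integrable_normalized_trace k n :
  P.-integrable [set: Omega] (fun w => (normalized_trace (X n w ^+ k))%:E).
Proof.
apply: le_integrable (integrable_trace_bound k) => //.
  by apply/measurable_EFinP; exact: measurable_normalized_trace.
move=> w _; apply: le_trans (normalized_trace_le k n w) _.
exact: lee_abs.
Qed.

Lemma cvg_integral_normalized_trace k :
  (\int[P]_w (normalized_trace (X n w ^+ k))%:E)%E @[n --> \oo] -->
    ((1 / 2 * k%:R + 1)^-1 * (walks k 0)%:R)%:E.
Proof.
set l := (_ * _ : R).
have mT n : measurable_fun [set: Omega] (fun w => (normalized_trace (X n w ^+ k))%:E).
  by apply/measurable_EFinP; exact: measurable_normalized_trace.
have cT : {ae P, forall w, [set: Omega] w ->
    (normalized_trace (X n w ^+ k))%:E @[n --> \oo] --> cst l%:E w}.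
  apply: filterS (ae_cvg_normalized_trace k) => w cw _.
  by apply: cvg_EFin => //; apply: nearW.
have bT : {ae P, forall w n, [set: Omega] w ->
    (`|(normalized_trace (X n w ^+ k))%:E| <= trace_bound k w)%E}.
  by apply: aeW => w n _; exact: normalized_trace_le.
have lE : (\int[P]_w (cst l%:E w) = l%:E)%E.
  rewrite integral_cst// -[RHS]mule1; congr (_ * _)%E; exact: probability_setT.
have [_ _] := dominated_convergence measurableT mT (measurable_cst _) cT
  (integrable_trace_bound k) bT.
by rewrite lE.
Qed.

End beta_trace.

(** * Conclusion *)

Theorem corollary1 (R : realType) (alpha : R) (alpha_gt0 : 0 < alpha)
    (m : nat -> R) (m_even : forall k, ~~ odd k -> m k = 1) :
  [/\
    forall k : nat,
      (ullman alpha_gt0).-integrable [set: R] (fun x => (x ^+ k)%:E) /\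
      (\int[ullman alpha_gt0]_x (x ^+ k)%:E = (path_moment alpha m k)%:E)%E,
    forall (d : measure_display) (Omega : measurableType d)
        (P : probability Omega R) (T W : {RV P >-> R}),
      has_law P T (uniform_prob (@ltr01 R)) -> has_law P W (@arcsine R) ->
      independent2 T W ->
      has_law P (fun w => T w `^ alpha * W w) (ullman alpha_gt0),
    [/\ {ae lebesgue_measure, forall x : R, ullman_pdf (1 / 4) x =
           (\1_`[-2, 2] x *
             ((2 + x ^+ 2) * Num.sqrt (4 - x ^+ 2) / (6 * pi)))%:E},
        {ae lebesgue_measure, forall x : R, ullman_pdf (1 / 2) x =
           (\1_`[-2, 2] x * (1 / (2 * pi) * Num.sqrt (4 - x ^+ 2)))%:E}
      & {ae lebesgue_measure, forall x : R, ullman_pdf 1 x =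
           (\1_`[-2, 2] x *
             (1 / (2 * pi) * ln ((2 + Num.sqrt (4 - x ^+ 2)) / `|x|)))%:E}]
  & forall (beta : R), 0 < beta ->
    forall (d : measure_display) (Omega : measurableType d)
        (P : probability Omega R) (dv bv : nat -> {RV P >-> R}),
      beta_model beta dv bv ->
    forall k : nat,
    let tr_Xk (n : nat) (w : Omega) : R :=
      normalized_trace
        (scaled_beta_matrix (fun i => dv i w) (fun i => bv i w) n ^+ k) in
    [/\ forall n, P.-integrable [set: Omega] (fun w => (tr_Xk n w)%:E),
        ('E_P[tr_Xk n])%E @[n --> \oo] --> (\int[@semicircle R]_x x ^+ k)%:E
      & {ae P, forall w, tr_Xk n w @[n --> \oo] -->
           \int[@semicircle R]_x x ^+ k}]].
Proof.
split=> [k|d Omega P T W|/=|beta beta_gt0 d Omega P dv bv [_ beta_dv beta_bv] k tr_Xk].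
- rewrite (path_momentE R alpha m m_even); exact: ullman_moment.
- exact: has_law_powR_mul.
- by split; [exact: ullman_pdf_quarter|exact: ullman_pdf_half|exact: ullman_pdf_one].
- rewrite semicircle_moment; split.
  + exact: integrable_normalized_trace beta_gt0 _ _ beta_dv beta_bv k.
  + rewrite unlock.
    exact: cvg_integral_normalized_trace beta_gt0 _ _ beta_dv beta_bv k.
  + exact: ae_cvg_normalized_trace beta_gt0 _ _ beta_dv beta_bv k.
Qed.
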